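(* Let $l\ge 1$ and let $(R,G)$ be a marked elliptic root system belonging to a real vector space equipped with a symmetric bilinear form of signature $(l,2,0)$. Assume that $R$ is reduced and that the affine quotient root system $R/G$ is non-reduced. Then $(R,G)$ is isomorphic, as a marked elliptic root system, to one of $$BC_l^{(1,2)},\quad BC_l^{(1,1)\ast},\quad BC_l^{(4,2)},\quad BC_l^{(4,4)\ast},\quad BC_l^{(2,2)\sigma}(2)\qquad(l\ge 1),$$ or, when $l\ge 2$, to $BC_l^{(2,2)\sigma}(1)$.
   Context: Root systems. Let $F$ be a finite-dimensional real vector space with a symmetric bilinear form $I$. For $\alpha\in F$ with $I(\alpha,\alpha)\ne0$ put $\alpha^\vee=2\alpha/I(\alpha,\alpha)$ and $r_\alpha(\lambda)=\lambda-I(\alpha^\vee,\lambda)\alpha$. A root system belonging to $(F,I)$ is a subset $R\subset F\setminus\{0\}$ such that: (R1) the subgroup $Q(R)$ generated by $R$ is a full lattice in $F$; (R2) $I(\alpha,\alpha)\neq0$ for $\alpha\in R$; (R3) $r_\alpha(R)=R$ for $\alpha\in R$; (R4) $I(\alpha^\vee,\beta)\in\mathbb Z$ for $\alpha,\beta\in R$; (R5) if $R=R_1\sqcup R_2$ with $R_1\perp R_2$, then $R_1=\emptyset$ or $R_2=\emptyset$. $R$ is reduced if $\alpha,c\alpha\in R$ ($c\in\mathbb R$) implies $c=\pm1$, otherwise non-reduced. $R$ is elliptic if $I$ has signature $(l,2,0)$ ($l$ positive directions, $2$-dimensional radical, no negative direction), affine if the signature is $(l,1,0)$. A marked elliptic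 root system (mERS) is a pair $(R,G)$ with $R$ an elliptic root system and $G\subset\mathrm{rad}(I)$ a one-dimensional subspace such that $G\cap Q(R)$ has rank $1$. Its affine quotient $R/G$ is the image of $R$ in $F/G$, an affine root system for the induced form. Two mERSs $(R_1,G_1)$, $(R_2,G_2)$ in $F_1,F_2$ are isomorphic if there is a linear isomorphism $\varphi:F_1\to F_2$ with $\varphi(R_1)=R_2$, $\varphi(G_1)=G_2$. The listed types. Let $F=\bigoplus_{i=1}^l\mathbb R\varepsilon_i\oplus\mathbb Rb\oplus\mathbb Ra$ with $I(\varepsilon_i,\varepsilon_j)=\delta_{ij}$ and $\mathrm{rad}(I)=\mathbb Ra\oplus\mathbb Rb$, and $G=\mathbb Ra$. Put $B_s=\{\pm\varepsilon_i\}_{1\le i\le l}$, $B_m=\{\pm\varepsilon_i\pm\varepsilon_j\}_{1\le i<j\le l}$ (empty if $l=1$), $B_l=\{\pm2\varepsilon_i\}_{1\le i\le l}$. For subsets $S,L,E$ of $\Lambda=\mathbb Za\oplus\mathbb Zb$ let $R(S,L,E)=(B_s+S)\cup(B_m+L)\cup(B_l+E)$. The type is given by the triple $(S,L,E)$: - $BC_l^{(1,2)}$: $(\Lambda,\ \Lambda,\ (1+2\mathbb Z)a+\mathbb Zb)$; - $BC_l^{(1,1)\ast}$: $(\Lambda,\ \Lambda,\ \{ma+nb: m,n\in\mathbb Z,\ (m-1)(n-1)\equiv0\bmod 2\})$; - $BC_l^{(4,2)}$: $(\Lambda,\ \mathbb Za+2\mathbb Zb,\ (1+2\mathbb Z)a+4\mathbb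 Zb)$; - $BC_l^{(4,4)\ast}$: $(\{ma+nb: m,n\in\mathbb Z,\ (m-1)(n-1)\equiv0\bmod2\},\ 2\Lambda,\ 4\Lambda)$; - $BC_l^{(2,2)\sigma}(1)$: $(\Lambda,\ \Lambda,\ (1+2\mathbb Z)a+2\mathbb Zb)$; - $BC_l^{(2,2)\sigma}(2)$: $(\Lambda,\ \mathbb Za+2\mathbb Zb,\ (1+2\mathbb Z)a+2\mathbb Zb)$. *)

(* Defs.v *)
From HB Require Import structures.
From mathcomp Require Import all_boot all_order all_algebra.
From mathcomp Require Import boolp classical_sets reals.

Set Implicit Arguments.
Unset Strict Implicit.
Unset Printing Implicit Defensive.

Import Order.TTheory GRing.Theory Num.Theory.

Local Open Scope classical_set_scope.
Local Open Scope ring_scope.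

(** * Lattices *)

Definition int_gen (V : zmodType) (A : set V) : set V :=
  [set v | exists m (s : m.-tuple V),
             (forall x, x \in s -> A x) /\ inIntSpan s v].

(* A full lattice is the Z-span of an R-basis. *)
Definition full_lattice (K : realType) (F : vectType K) (A : set F) : Prop :=
  exists m (s : m.-tuple F), basis_of fullv s /\ A = [set v | inIntSpan s v].

Definition int_free (V : zmodType) m (s : m.-tuple V) : Prop :=
  forall c : 'I_m -> int, \sum_(i < m) s`_i *~ c i = 0 -> forall i, c i = 0.

(* A is a free abelian group of rank m; every subgroup of a lattice is free. *)
Definition has_rank (V : zmodType) (A : set V) (m : nat) : Prop :=
  exists s : m.-tuple V, int_free s /\ A = [set v | inIntSpan s v].

(** * Symmetric bilinear forms *)

(* p positive directions, a z-dimensional radical and n negative directions,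
   witnessed by an orthogonal basis. *)
Definition has_signature (K : realType) (F : vectType K) (I : {symmetric F})
    (p z n : nat) : Prop :=
  exists (P : p.-tuple F) (Z : z.-tuple F) (N : n.-tuple F),
    [/\ basis_of fullv (P ++ Z ++ N),
        pairwise (fun x y => I x y == 0) (P ++ Z ++ N),
        forall x, x \in P -> 0 < I x x,
        forall x, x \in Z -> I x x = 0
      & forall x, x \in N -> I x x < 0].

Definition radical (K : realType) (F : vectType K) (I : {symmetric F}) : set F :=
  [set x | forall y, I x y = 0].

(** * Root systems *)

Definition coroot (K : realType) (F : vectType K) (I : {symmetric F}) (a : F) : F :=
  (2 / I a a) *: a.

Definition root_refl (K : realType) (F : vectType K) (I : {symmetric F})
    (a v : F) : F :=
  v - I (coroot I a) v *: a.

Record root_system (K : realType) (F : vectType K) (I : {symmetric F})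
    (R : set F) : Prop := RootSystem {
  root_neq0 : ~ R 0;
  root_lattice : full_lattice (int_gen R);
  root_nonisotropic : forall a, R a -> I a a != 0;
  root_reflection : forall a, R a -> root_refl I a @` R = R;
  root_integral : forall a b, R a -> R b -> I (coroot I a) b \is a Num.int;
  root_irreducible : forall R1 R2 : set F,
    R = R1 `|` R2 -> R1 `&` R2 = set0 ->
    (forall a b, R1 a -> R2 b -> I a b = 0) -> R1 = set0 \/ R2 = set0
}.

Definition reduced (K : realType) (V : lmodType K) (R : set V) : Prop :=
  forall (a : V) (c : K), R a -> R (c *: a) -> c = 1 \/ c = -1.

Record marked_elliptic (K : realType) (F : vectType K) (I : {symmetric F})
    (l : nat) (R : set F) (G : {vspace F}) : Prop := MarkedElliptic {
  mers_root_system : root_system I R;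
  mers_elliptic : has_signature I l 2 0;
  mers_marking_dim : \dim G = 1%N;
  mers_marking_radical : [set` G] `<=` radical I;
  mers_marking_rank : has_rank ([set` G] `&` int_gen R) 1
}.

(* The form does not enter the notion of isomorphism. *)
Definition mers_isomorphic (K : realType) (F1 F2 : vectType K)
    (R1 : set F1) (G1 : {vspace F1}) (R2 : set F2) (G2 : {vspace F2}) : Prop :=
  exists phi : 'Hom(F1, F2),
    [/\ bijective phi, phi @` R1 = R2 & (phi @: G1)%VS = G2].

(** * Quotient spaces *)

(* F / G is modelled on the complement G^C, with the projection along G as the
   canonical map; [lker_quo_map] and [limg_quo_map] characterize it. *)
Definition quo_space (K : realType) (F : vectType K) (G : {vspace F}) :
  vectType K := subvs_of (G^C)%VS.

Definition quo_map (K : realType) (F : vectType K) (G : {vspace F}) :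
    'Hom(F, quo_space G) :=
  (linfun (vsproj (G^C)%VS) \o (\1 - projv G))%VF.

Lemma quo_mapE (K : realType) (F : vectType K) (G : {vspace F}) (x : F) :
  vsval (quo_map G x) = x - projv G x.
Proof.
by rewrite comp_lfunE lfunE /= add_lfunE opp_lfunE id_lfunE vsprojK // memv_projC.
Qed.

Lemma lker_quo_map (K : realType) (F : vectType K) (G : {vspace F}) :
  lker (quo_map G) = G.
Proof.
apply/vspaceP => x; rewrite memv_ker -(inj_eq subvs_inj) quo_mapE [X in _ == X]linear0.
rewrite subr_eq0; apply/eqP/idP => [->|xG]; first exact: memv_proj.
by rewrite projv_id.
Qed.

Lemma limg_quo_map (K : realType) (F : vectType K) (G : {vspace F}) :
  limg (quo_map G) = fullv.
Proof.
apply/vspaceP => y; rewrite memvf; apply/memv_imgP.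
exists (vsval y); first exact: memvf.
apply: subvs_inj; rewrite quo_mapE.
suff /eqP -> : projv G (vsval y) == 0 by rewrite subr0.
by rewrite -memv_ker lker_proj subvsP.
Qed.

Definition quo_roots (K : realType) (F : vectType K) (R : set F)
    (G : {vspace F}) : set (quo_space G) :=
  quo_map G @` R.
Arguments quo_roots [K F] R G _.

(** * The types BC_l *)

(* The coordinates of (u, y, x) are those of u on the eps_i, y on b, x on a. *)
Definition std_space (K : realType) (l : nat) : vectType K :=
  ('rV[K]_l * K^o * K^o)%type.

Definition std_eps (K : realType) (l : nat) (i : 'I_l) : std_space K l :=
  (delta_mx 0 i, 0, 0).
Definition std_b (K : realType) (l : nat) : std_space K l := (0, 1, 0).
Definition std_a (K : realType) (l : nat) : std_space K l := (0, 0, 1).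

Definition std_marking (K : realType) (l : nat) : {vspace std_space K l} :=
  <[std_a K l]>%VS.

Definition short_roots (K : realType) (l : nat) : set (std_space K l) :=
  [set x | exists (s : bool) (i : 'I_l), x = (-1) ^+ s *: std_eps K i].

Definition middle_roots (K : realType) (l : nat) : set (std_space K l) :=
  [set x | exists (s t : bool) (i j : 'I_l), (i < j)%N /\
             x = (-1) ^+ s *: std_eps K i + (-1) ^+ t *: std_eps K j].

Definition long_roots (K : realType) (l : nat) : set (std_space K l) :=
  [set x | exists (s : bool) (i : 'I_l), x = (-1) ^+ s *: (2 *: std_eps K i)].

(* A subset of Lambda = Z a + Z b is given by the pairs (m, n) of coordinates of
   its elements m a + n b. *)
Definition translates (K : realType) (l : nat) (B : set (std_space K l))
    (T : set (int * int)) : set (std_space K l) :=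
  [set x + (std_a K l *~ p.1 + std_b K l *~ p.2) | x in B & p in T].

Definition std_roots (K : realType) (l : nat) (S L E : set (int * int)) :
    set (std_space K l) :=
  translates (@short_roots K l) S `|` translates (@middle_roots K l) L
    `|` translates (@long_roots K l) E.

Definition lat_all : set (int * int) := setT.

Definition lat_scale (k : int) : set (int * int) :=
  [set (k * i, k * j) | i in setT & j in setT].

(* Z a + 2 Z b *)
Definition lat_a2b : set (int * int) := [set (i, 2 * j) | i in setT & j in setT].

(* (1 + 2 Z) a + k Z b *)
Definition lat_odd (k : int) : set (int * int) :=
  [set (1 + 2 * i, k * j) | i in setT & j in setT].

Definition lat_star : set (int * int) :=
  [set p | ((p.1 - 1) * (p.2 - 1) = 0 %[mod 2])%Z].

Definition BC_1_2 (K : realType) (l : nat) : set (std_space K l) :=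
  std_roots lat_all lat_all (lat_odd 1).
Definition BC_1_1_star (K : realType) (l : nat) : set (std_space K l) :=
  std_roots lat_all lat_all lat_star.
Definition BC_4_2 (K : realType) (l : nat) : set (std_space K l) :=
  std_roots lat_all lat_a2b (lat_odd 4).
Definition BC_4_4_star (K : realType) (l : nat) : set (std_space K l) :=
  std_roots lat_star (lat_scale 2) (lat_scale 4).
Definition BC_2_2_sigma_1 (K : realType) (l : nat) : set (std_space K l) :=
  std_roots lat_all lat_all (lat_odd 2).
Definition BC_2_2_sigma_2 (K : realType) (l : nat) : set (std_space K l) :=
  std_roots lat_all lat_a2b (lat_odd 2).

Arguments BC_1_2 K l _ : clear implicits.
Arguments BC_1_1_star K l _ : clear implicits.
Arguments BC_4_2 K l _ : clear implicits.
Arguments BC_4_4_star K l _ : clear implicits.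
Arguments BC_2_2_sigma_1 K l _ : clear implicits.
Arguments BC_2_2_sigma_2 K l _ : clear implicits.

(* Main.v *)
From HB Require Import structures.
Require Import Defs.
From mathcomp Require Import all_boot all_order all_algebra.
From mathcomp Require Import boolp classical_sets reals.
From mathcomp Require Import ring lra zify.

Set Implicit Arguments.
Unset Strict Implicit.
Unset Printing Implicit Defensive.

Import Order.TTheory GRing.Theory Num.Theory.

Local Open Scope classical_set_scope.
Local Open Scope ring_scope.

(** The form is positive definite modulo its radical [W]. Since [R/G] is not reduced, there are
    roots [x] and [y] with [y = 2 x] modulo [G]; let [c] be the norm of [x]. Call a root of
    norm [c] doubled if its double is congruent to a root modulo [W]. Integrality shows that
    a root not orthogonal to a doubled root [x] is congruent to [+- x] or [+- 2 x], or is
    [+- (x - z)] with [z] another doubled root, orthogonal to [x] ([doubled_pairing]). Take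
    a maximal orthogonal family [e] of doubled roots. By irreducibility all roots are
    congruent to [+- e_i], [+- 2 e_i] or [+- e_i +- e_j] ([doubled_family_shape]), any two members
    of the family are linked by a root of the last kind ([all_linked]), and translating the
    members along [W] makes their differences roots ([normalized_family]). As the roots span
    [F], the family has [l] members. Together with a basis [a, b] of the radical part of the root
    lattice such that [a] spans [G] ([lattice_basis]), it yields an adapted frame
    ([adapted_frame_exists]), in which [R] is the set [R(S, L, E)].

    The reflections then translate into closure properties of [S], [L] and [E]
    ([frame_translation_sets]). In particular [S] contains [0], generates
    [Lambda = Z a + Z b] and is a union of classes modulo [2 Lambda]: it is the whole lattice or
    misses exactly one class. Moreover [E] is a union of classes modulo [4 Lambda] and is disjoint
    from [2 S], as [R] is reduced. If [S] misses a class [z], then [E = 2 z + 4 Lambda] and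
    [L = 2 Lambda], which is the type [BC_l^(4,4)*] once translations of short roots are
    counted from [e_i + z] ([classify_star]). If [S = Lambda], then [E] contains an element congruent to [a] modulo
    [2 Lambda], and [L] is [Lambda] or [Z a + 2 Z b] if [l >= 2]; the few possibilities for [E] are
    the other types, up to a change of [b] into [a + b] or of [e_i] into [e_i + b]
    ([classify_full]). Both changes come from a linear isomorphism that
    preserves [G] ([frame_isomorphic]). *)

(** * Symmetric bilinear forms *)

Section SymmetricForm.
Variables (K : realType) (F : vectType K) (I : {symmetric F}).

Lemma bilC x y : I x y = I y x.
Proof. by rewrite hermC expr0 mul1r. Qed.

Lemma bilDl x y z : I (x + y) z = I x z + I y z. Proof. exact: linearDl. Qed.
Lemma bilDr x y z : I x (y + z) = I x y + I x z. Proof. exact: linearDr. Qed.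
Lemma bilNl x y : I (- x) y = - I x y. Proof. exact: linearNl. Qed.
Lemma bilNr x y : I x (- y) = - I x y. Proof. exact: linearNr. Qed.
Lemma bilZl c x y : I (c *: x) y = c * I x y. Proof. exact: linearZl_LR. Qed.
Lemma bilZr c x y : I x (c *: y) = c * I x y. Proof. exact: linearZr_LR. Qed.
Lemma bil0r x : I x 0 = 0. Proof. exact: linear0r. Qed.
Lemma bil_suml T (r : seq T) (P : pred T) (f : T -> F) y :
  I (\sum_(i <- r | P i) f i) y = \sum_(i <- r | P i) I (f i) y.
Proof. exact: linear_sumlz. Qed.
Lemma bil_sumr T (r : seq T) (P : pred T) (f : T -> F) y :
  I y (\sum_(i <- r | P i) f i) = \sum_(i <- r | P i) I y (f i).
Proof. exact: linear_sumr. Qed.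

Definition bilE := (bilDl, bilDr, bilNl, bilNr, bilZl, bilZr).

(** An elliptic form is positive semidefinite, and its isotropic vectors form
    its radical [W], a plane. *)
Lemma elliptic_radical l : has_signature I l 2 0 ->
  exists W : {vspace F}, [/\ \dim W = 2%N, \dim {:F} = (l + 2)%N,
    forall x, x \in W -> forall y, I x y = 0,
    forall x, 0 <= I x x
  & forall x, I x x = 0 -> x \in W].
Proof.
move=> [P [Z [N [basX orthX posP zeroZ _]]]].
have N0 : tval N = [::] by apply: size0nil; rewrite size_tuple.
rewrite N0 cats0 in basX orthX.
pose X : (l + 2).-tuple F := [tuple of P ++ Z].
have basX' : basis_of fullv X by [].
have freeX : free (P ++ Z) := basis_free basX.
have orth (i j : 'I_(l + 2)) : i != j -> I X`_i X`_j = 0.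
  wlog ltij : i j / (i < j)%N => [hw nij|nij].
    have [/hw|ltji] := ltnP i j; first exact.
    rewrite bilC; apply: hw; last by rewrite eq_sym.
    by rewrite ltn_neqAle ltji andbT eq_sym.
  move/(pairwiseP 0): orthX => /(_ i j).
  by rewrite !inE size_cat !size_tuple !ltn_ord => /(_ isT isT ltij) /eqP.
have expand x : x = \sum_i coord X i x *: X`_i.
  by apply: coord_basis (memvf x).
(* the form is diagonal in the basis X *)
have diag x y : I x y = \sum_i coord X i x * coord X i y * I X`_i X`_i.
  rewrite [in LHS](expand x) bil_suml; apply: eq_bigr => i _.
  rewrite [in LHS](expand y) bil_sumr (bigD1 i) //= big1 => [|j nji].
    by rewrite addr0 !bilE mulrA.
  by rewrite !bilE (orth i j) 1?eq_sym // !mulr0.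
have memP (i : 'I_(l + 2)) : (i < l)%N -> X`_i \in P.
  by move=> il; rewrite /= nth_cat size_tuple il mem_nth // size_tuple.
have memZ (i : 'I_(l + 2)) : (l <= i)%N -> X`_i \in Z.
  move=> il; rewrite /= nth_cat size_tuple ltnNge il /= mem_nth // size_tuple.
  by rewrite ltn_subLR ?ltn_ord.
have pos (i : 'I_(l + 2)) : 0 <= I X`_i X`_i.
  have [il|il] := ltnP i l; first by rewrite ltW ?posP ?memP.
  by rewrite zeroZ //; apply: memZ.
exists <<Z>>%VS; split.
- by have /eqP := catr_free freeX; rewrite size_tuple.
- by have := size_basis basX'.
- move=> x /coord_span -> y; rewrite bil_suml big1 // => k _; rewrite bilZl.
  have kZ : Z`_k \in Z by rewrite mem_nth // size_tuple.
  have kX : Z`_k \in X by rewrite mem_cat kZ orbT.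
  have [i iX Xi] := nthP 0 kX; rewrite size_tuple in iX.
  rewrite -Xi (expand y) bil_sumr big1 ?mulr0 // => j _; rewrite bilZr.
  have [<-|nij] := eqVneq (Ordinal iX) j; last by rewrite (orth (Ordinal iX)) ?mulr0.
  by rewrite /= [nth _ _ _]Xi (zeroZ _ kZ) mulr0.
- by move=> x; rewrite diag sumr_ge0 // => i _; rewrite mulr_ge0 // -expr2 sqr_ge0.
- move=> x; rewrite diag => /psumr_eq0P h.
  rewrite (expand x) memv_suml // => i _.
  have [il|il] := ltnP i l; last by rewrite memvZ // memv_span // memZ.
  have /eqP : coord X i x * coord X i x * I X`_i X`_i = 0.
    by apply: h => // j _; rewrite mulr_ge0 // -expr2 sqr_ge0.
  rewrite !mulf_eq0 orbb => /orP [/eqP ->|]; first by rewrite scale0r mem0v.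
  by rewrite gt_eqF // posP // memP.
Qed.
End SymmetricForm.
Arguments bilC {K F I} x y.

(** * Roots modulo the radical *)

Section VectorCoordinates.
Variables (K : realType) (F : vectType K).

(** The [i]-th coordinate of a vector in a fixed basis. *)
Definition vcoord (i : 'I_(\dim {:F})) (x : F) : K := coord (vbasis {:F}) i x.

Lemma vcoordD i x y : vcoord i (x + y) = vcoord i x + vcoord i y.
Proof. exact: linearD. Qed.
Lemma vcoordN i x : vcoord i (- x) = - vcoord i x.
Proof. exact: linearN. Qed.
Lemma vcoordZ i c x : vcoord i (c *: x) = c * vcoord i x.
Proof. exact: linearZ. Qed.
Lemma vcoord0 i : vcoord i 0 = 0.
Proof. exact: linear0. Qed.
Definition vcoordE := (vcoordD, vcoordN, vcoordZ, vcoord0).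

Lemma vcoord_inj x y : (forall i, vcoord i x = vcoord i y) -> x = y.
Proof.
move=> h; rewrite (coord_vbasis (memvf x)) (coord_vbasis (memvf y)).
by apply: eq_bigr => i _; congr (_ *: _); apply: h.
Qed.

End VectorCoordinates.

(** [vring] proves identities between linear combinations of vectors, by comparing coordinates. *)
Ltac vring := apply: vcoord_inj => ?; rewrite ?vcoordE; ring.

Section RootsModuloRadical.
Variables (K : realType) (F : vectType K) (I : {symmetric F}).
Variables (W : {vspace F}) (R : set F).
Hypothesis radW : forall x, x \in W -> forall y, I x y = 0.
Hypothesis bil_ge0 : forall x, 0 <= I x x.
Hypothesis bil_eq0 : forall x, I x x = 0 -> x \in W.
Hypothesis rsR : root_system I R.

Lemma radWr x y : y \in W -> I x y = 0.
Proof. by move=> yW; rewrite bilC radW. Qed.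

Lemma bil_congl x y z : x - y \in W -> I x z = I y z.
Proof. by move=> xy; rewrite -[x in LHS](subrK y) bilDl (radW xy) add0r. Qed.

Lemma bil_congr x y z : x - y \in W -> I z x = I z y.
Proof. by move=> xy; rewrite (bilC z x) (bilC z y) (bil_congl _ xy). Qed.

Lemma root_norm_gt0 x : R x -> 0 < I x x.
Proof. by move=> /(root_nonisotropic rsR) nz; rewrite lt_def nz bil_ge0. Qed.

Lemma root_reflect n x y : R x -> R y -> 2 * I x y = n * I x x -> R (y - n *: x).
Proof.
move=> Rx Ry h; rewrite -(root_reflection rsR Rx); exists y => //.
rewrite /root_refl /coroot bilZl; congr (_ - _ *: _).
apply: (mulIf (root_nonisotropic rsR Rx)); rewrite -h; field.
exact: (root_nonisotropic rsR Rx).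
Qed.

Lemma root_opp x : R x -> R (- x).
Proof.
move=> Rx; have -> : - x = x - 2 *: x by vring.
exact: root_reflect.
Qed.

Lemma root_pairing_int x y : R x -> R y ->
  exists n : int, 2 * I x y = n%:~R * I x x.
Proof.
move=> Rx Ry; have /intrP[n hn] := root_integral rsR Rx Ry.
exists n; rewrite -hn /coroot bilZl; field.
exact: (root_nonisotropic rsR Rx).
Qed.

(** The roots of norm [c] whose double is congruent to a root modulo [W]. *)
Definition doubled (c : K) (x : F) : Prop :=
  [/\ R x, I x x = c & exists2 y, R y & y - 2 *: x \in W].

Lemma doubled_reflect c k x y : doubled c x -> R y -> 2 * I y x = k * I y y ->
  doubled c (x - k *: y).
Proof.
move=> [Rx xc [z Rz zx]] Ry h; split.
- exact: root_reflect.
- rewrite !bilE (bilC x y) xc; transitivity (c - k * (2 * I y x - k * I y y)).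
    by ring.
  by rewrite h; ring.
- exists (z - (2 * k) *: y).
    by apply: root_reflect => //; rewrite (bil_congr _ zx) !bilE -mulrA -h; ring.
  by rewrite (_ : _ - _ = z - 2 *: x) //; vring.
Qed.

(** As both [x] and its double pair integrally with the coroots and [y] pairs integrally
    with the coroot of the double, the Cauchy-Schwarz inequality leaves three cases:
    [y] is orthogonal to [x], or congruent to [+- x] or [+- 2 x], or it is up to sign the
    difference of [x] and an orthogonal doubled root. *)
Lemma doubled_pairing c x y : 0 < c -> doubled c x -> R y ->
  exists n : int, I x y = n%:~R * c /\
    [\/ n = 0,
        (n = 1 \/ n = -1 \/ n = 2 \/ n = -2) /\ y - n%:~R *: x \in W
      | (n = 1 \/ n = -1) /\ exists z,
          [/\ doubled c z, I x z = 0 & y = n%:~R *: (x - z)]].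
Proof.
move=> c_gt0 Dx Ry; have [Rx xc [z Rz zx]] := Dx.
have [n hn] := root_pairing_int Rz Ry; have [k hk] := root_pairing_int Ry Rx.
have zz : I z z = 4 * c.
  by rewrite (bil_congl _ zx) bilZl (bil_congr _ zx) bilZr xc; ring.
rewrite (bil_congl _ zx) bilZl zz in hn.
have xy : I x y = n%:~R * c.
  by move: hn; set u := n%:~R; nra.
exists n; split=> //.
have [->|n0] := eqVneq n 0; first by constructor 1.
have diff : I (y - n%:~R *: x) (y - n%:~R *: x) = I y y - n%:~R ^+ 2 * c.
  by rewrite !bilE (bilC y x) xy xc; ring.
(* Cauchy-Schwarz *)
have := bil_ge0 (y - n%:~R *: x); rewrite diff subr_ge0 => le_norm.
have n2_gt0 : 0 < (n%:~R ^+ 2 * c : K) by rewrite mulr_gt0 // exprn_even_gt0 //= intr_eq0.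
have N_gt0 := lt_le_trans n2_gt0 le_norm.
rewrite bilC xy in hk.
have kn : (k * n)%:~R * I y y = 2 * (n%:~R ^+ 2 * c).
  by rewrite intrM mulrAC -hk; ring.
(* k n is twice the squared cosine of the angle between x and y modulo W: it is 1 or 2 *)
have kn_gt0 : 0 < k * n.
  by rewrite -(ltr0z K) -(pmulr_lgt0 _ N_gt0) kn mulr_gt0.
have kn_le2 : k * n <= 2.
  rewrite leNgt; apply/negP => kn3.
  have : (3 : K) <= (k * n)%:~R by rewrite (_ : 3 = (3 : int)%:~R) ?ler_int.
  move=> h3; have : 3 * I y y <= (k * n)%:~R * I y y by rewrite ler_pM2r.
  by rewrite kn => ?; lra.
have [kn1|kn2] : k * n = 1 \/ k * n = 2 by lia.
- constructor 3.
  have n1 : n = 1 \/ n = -1.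
    by have := dvdz_mull k (dvdzz n); rewrite kn1 dvdz1; lia.
  have kn_eq : k = n by case: n1 => n1; rewrite n1 in kn1 *; lia.
  split=> //.
  have nn : n%:~R * n%:~R = 1 :> K by case: n1 => ->; ring.
  exists (x - n%:~R *: y); split.
  + by apply: doubled_reflect => //; rewrite bilC xy hk kn_eq.
  + rewrite !bilE xy xc; transitivity (c - n%:~R * n%:~R * c); first by ring.
    by rewrite nn; ring.
  + rewrite (_ : x - _ = n%:~R *: y); last by vring.
    by rewrite scalerA nn scale1r.
- constructor 2; split.
    by have := dvdz_mull k (dvdzz n); rewrite kn2 dvdzE => /dvdn_leq; lia.
  by apply: bil_eq0; rewrite diff; move: kn; rewrite kn2 => kn; lra.
Qed.

End RootsModuloRadical.

(** * Orthogonal frames of doubled roots *)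

Lemma int_signP (K : realType) (n : int) : n = 1 \/ n = -1 ->
  exists s : bool, n%:~R = (-1) ^+ s :> K.
Proof. by case=> ->; [exists false | exists true; rewrite expr1]. Qed.

Lemma sign_opp (K : realType) (s : bool) : - (-1) ^+ s = (-1) ^+ (~~ s) :> K.
Proof. by case: s; rewrite ?expr0 ?expr1 ?opprK. Qed.

Lemma sign_mulss (K : realType) (s : bool) : (-1) ^+ s * (-1) ^+ s = 1 :> K.
Proof. by case: s; rewrite ?expr0 ?expr1 ?mulrNN mulr1. Qed.

Lemma memv_eq (K : fieldType) (F : vectType K) (W : {vspace F}) x y :
  x \in W -> x = y -> y \in W.
Proof. by move=> xW <-. Qed.

Section RootFrames.
Variables (K : realType) (F : vectType K) (I : {symmetric F}).
Variables (W : {vspace F}) (R : set F) (c : K).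
Hypothesis radW : forall x, x \in W -> forall y, I x y = 0.
Hypothesis bil_ge0 : forall x, 0 <= I x x.
Hypothesis bil_eq0 : forall x, I x x = 0 -> x \in W.
Hypothesis rsR : root_system I R.
Hypothesis c_gt0 : 0 < c.

Let cong_l := bil_congl radW.
Let cong_r := bil_congr radW.
Let c_neq0 : c != 0. Proof. by rewrite gt_eqF. Qed.

(** The vectors [e i] are pairwise orthogonal, of norm [c]. *)
Definition orthogonal_family k (e : 'I_k -> F) : Prop :=
  forall i j, I (e i) (e j) = (i == j)%:R * c.

Lemma orthogonal_family_coef k (e : 'I_k -> F) (u : 'I_k -> K) i :
  orthogonal_family e -> I (e i) (\sum_j u j *: e j) = u i * c.
Proof.
move=> orth; rewrite bil_sumr (bigD1 i) //= big1 => [|j ji].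
  by rewrite bilZr orth eqxx mul1r addr0.
by rewrite bilZr orth eq_sym (negPf ji) mul0r mulr0.
Qed.

Lemma orthogonal_family_free k (e : 'I_k -> F) :
  orthogonal_family e -> free [seq e i | i : 'I_k].
Proof.
move=> orth; have -> : [seq e i | i : 'I_k] = tval [tuple e i | i < k].
  by rewrite /= -[map _ _]/(codom e).
apply/freeP => u u0 i; apply: (mulIf c_neq0); rewrite mul0r.
rewrite -(orthogonal_family_coef u i orth) (_ : \sum_j _ = 0) ?bil0r // -[RHS]u0.
by apply: eq_bigr => j _; rewrite -tnth_nth tnth_mktuple.
Qed.

Lemma orthogonal_family_cap k (e : 'I_k -> F) : orthogonal_family e ->
  (<<[seq e i | i : 'I_k]>> :&: W = 0)%VS.
Proof.
move=> orth; apply/eqP; rewrite -subv0; apply/subvP => x.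
have -> : [seq e i | i : 'I_k] = tval [tuple e i | i < k].
  by rewrite /= -[map _ _]/(codom e).
rewrite memv_cap memv0 => /andP[/coord_span xe xW].
have xE : x = \sum_j coord [tuple e i | i < k] j x *: e j.
  by rewrite {1}xe; apply: eq_bigr => j _; rewrite -tnth_nth tnth_mktuple.
rewrite xE big1 // => j _; suff -> : coord [tuple e i | i < k] j x = 0 by rewrite scale0r.
apply: (mulIf c_neq0); rewrite mul0r.
rewrite -(orthogonal_family_coef (coord [tuple e i | i < k] ^~ x) j orth) -xE.
exact: radWr radW _ _ xW.
Qed.

(** An orthogonal family of doubled roots is free, so that one of maximal size exists. *)
Lemma maximal_doubled_family :
  exists k (e : 'I_k -> F), [/\ forall i, doubled I W R c (e i),
    orthogonal_family e
  & forall x, doubled I W R c x -> exists i, I (e i) x != 0].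
Proof.
pose P k := exists e : 'I_k -> F,
  (forall i, doubled I W R c (e i)) /\ orthogonal_family e.
have P0 : exists k, `[< P k >].
  by exists 0%N; apply/asboolP; exists (fun=> 0); split; case.
have Pub k : `[< P k >] -> (k <= \dim {:F})%N.
  move=> /asboolP[e [_ /orthogonal_family_free/eqP]].
  by rewrite size_map size_enum_ord => <-; rewrite dimvS // subvf.
case: (ex_maxnP P0 Pub) => k /asboolP[e [De orth]] max.
exists k, e; split=> // x Dx; apply: contrapT => /forallNP none.
have {}none i : I (e i) x = 0 by apply/eqP/negPn/negP/none.
suff /asboolP/max : P k.+1 by rewrite ltnn.
exists (fun i => if unlift ord0 i is Some j then e j else x); split=> [i|i j].
  by case: unliftP.
case: unliftP => [i' ->|->]; case: unliftP => [j' ->|->].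
- by rewrite orth (inj_eq lift_inj).
- by rewrite none mul0r.
- by rewrite bilC none mul0r.
- by rewrite eqxx mul1r; case: Dx.
Qed.

(** The three possible forms, modulo the radical, of a root of a system of type [BC]. *)
Definition BC_shape k (e : 'I_k -> F) (y : F) : Prop :=
  [\/ exists (s : bool) i, y - (-1) ^+ s *: e i \in W,
      exists (s : bool) i, y - (-1) ^+ s *: (2 *: e i) \in W
    | exists (s t : bool) i j, i != j /\
        y - ((-1) ^+ s *: e i + (-1) ^+ t *: e j) \in W].

(** A doubled root is congruent to [e i] up to sign for some [i]. Hence every root not orthogonal to
    the family is congruent to a combination of its members; by
    irreducibility no root is orthogonal to the family. *)
Lemma doubled_family_shape k (e : 'I_k -> F) :
  (forall i, doubled I W R c (e i)) -> orthogonal_family e ->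
  (forall x, doubled I W R c x -> exists i, I (e i) x != 0) -> (0 < k)%N ->
  forall y, R y -> BC_shape e y.
Proof.
move=> De orth max k_gt0.
have normE i : I (e i) (e i) = c by case: (De i).
have near x : doubled I W R c x -> exists (s : bool) i, x - (-1) ^+ s *: e i \in W.
  move=> Dx; have [i ix] := max x Dx; have [Rx xc _] := Dx.
  have [n [hn [n0|[hn' xW]|[n1 [z [Dz iz xE]]]]]] :=
    doubled_pairing radW bil_ge0 bil_eq0 rsR c_gt0 (De i) Rx.
  - by move: ix; rewrite hn n0 mul0r eqxx.
  - have : I x x = n%:~R ^+ 2 * c.
      by rewrite (cong_l _ xW) (cong_r _ xW) !bilE normE; ring.
    rewrite xc; case: hn' => [n1|[n1|hn']] eqc.
    + by have [s sE] := int_signP K (or_introl n1); exists s, i; rewrite -sE.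
    + by have [s sE] := int_signP K (or_intror n1); exists s, i; rewrite -sE.
    + by move: c_gt0; case: hn' eqc => -> eqc; lra.
  - have [_ zc _] := Dz; have [s sE] := int_signP K n1.
    have : I x x = 2 * ((-1) ^+ s * (-1) ^+ s) * c.
      by rewrite xE sE !bilE (bilC z) iz normE zc; ring.
    by rewrite sign_mulss xc => ?; move: c_gt0; lra.
have shape_of i y : R y -> I (e i) y != 0 -> BC_shape e y.
  move=> Ry iy.
  have [n [hn [n0|[hn' yW]|[n1 [z [Dz iz yE]]]]]] :=
    doubled_pairing radW bil_ge0 bil_eq0 rsR c_gt0 (De i) Ry.
  - by move: iy; rewrite hn n0 mul0r eqxx.
  - case: hn' yW => [n1|[n1|[->|->]]] yW.
    + have [s sE] := int_signP K (or_introl n1).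
      by constructor 1; exists s, i; rewrite -sE.
    + have [s sE] := int_signP K (or_intror n1).
      by constructor 1; exists s, i; rewrite -sE.
    + by constructor 2; exists false, i; rewrite expr0 scale1r.
    + by constructor 2; exists true, i; rewrite expr1 scalerA mulN1r.
  - have [s sE] := int_signP K n1; have [t [j zj]] := near z Dz.
    constructor 3; exists s, (~~ (s (+) t)), i, j; split.
      apply/eqP => ij; move: iz; rewrite (cong_r _ zj) -ij bilZr normE => /eqP.
      by rewrite mulf_eq0 signr_eq0 (negPf c_neq0).
    rewrite yE sE -sign_opp signr_addb.
    rewrite (_ : _ - _ = - (-1) ^+ s *: (z - (-1) ^+ t *: e j)) ?memvZ //.
    by vring.
pose R1 := [set y | R y /\ exists i, I (e i) y != 0].
pose R2 := [set y | R y /\ forall i, I (e i) y = 0].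
have RU : R = R1 `|` R2.
  apply/seteqP; split=> [y Ry|y [[]|[]] //].
  have [h|/forallNP h] := pselect (exists i, I (e i) y != 0); first by left.
  by right; split=> // i; apply/eqP/negPn/negP/h.
have R12 : R1 `&` R2 = set0.
  by apply/seteqP; split=> [y [[_ [i iy]] [_ /(_ i) y0]]|//]; rewrite y0 eqxx in iy.
have orth12 x y : R1 x -> R2 y -> I x y = 0.
  move=> [Rx [i ix]] [Ry y0].
  case: (shape_of i x Rx ix) => [[s [j h]]|[s [j h]]|[s [t [j [m [_ h]]]]]];
    by rewrite (cong_l _ h) !bilE !y0; ring.
move=> y Ry; have [R1_0|R2_0] := root_irreducible rsR RU R12 orth12.
- pose i := Ordinal k_gt0; have : R1 (e i).
    by split; [case: (De i) | exists i; rewrite normE].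
  by rewrite R1_0.
- by move: (Ry); rewrite RU R2_0 setU0 => -[_ [i]]; apply: shape_of.
Qed.

Section Connectivity.
Variables (k : nat) (e : 'I_k -> F).
Hypothesis Re : forall i, R (e i).
Hypothesis orth : orthogonal_family e.
Hypothesis shape : forall y, R y -> BC_shape e y.

Let normE i : I (e i) (e i) = c. Proof. by rewrite orth eqxx mul1r. Qed.
Let orthE i j : i != j -> I (e i) (e j) = 0.
Proof. by move=> ij; rewrite orth (negPf ij) mul0r. Qed.

(** The indices [i] and [j] are linked if a root is congruent to [+- e i +- e j]. *)
Definition linked (i j : 'I_k) : Prop :=
  exists y (s t : bool), R y /\ y - ((-1) ^+ s *: e i + (-1) ^+ t *: e j) \in W.

Lemma linked_trans i j m : i != j -> j != m -> i != m ->
  linked i j -> linked j m -> linked i m.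
Proof.
move=> ij jm im [y [s [t [Ry yW]]]] [z [u [v [Rz zW]]]].
exists (z - ((-1) ^+ t * (-1) ^+ u) *: y), (~~ (t (+) u (+) s)), v; split.
  apply: (root_reflect rsR) => //.
  rewrite (cong_l _ yW) (cong_r _ zW) (cong_l y yW) (cong_r _ yW) !bilE.
  rewrite !normE (bilC (e j) (e i)) !orthE //.
  transitivity (2 * ((-1) ^+ t * (-1) ^+ u) * c); first by ring.
  transitivity (((-1) ^+ t * (-1) ^+ u) *
    ((-1) ^+ s * (-1) ^+ s + (-1) ^+ t * (-1) ^+ t) * c); last by ring.
  by rewrite !sign_mulss; ring.
rewrite -sign_opp !signr_addb.
have uE : (-1) ^+ u *: e j = ((-1) ^+ t * (-1) ^+ t * (-1) ^+ u) *: e j.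
  by rewrite sign_mulss mul1r.
rewrite uE in zW.
apply: memv_eq (memvB zW (memvZ ((-1) ^+ t * (-1) ^+ u) yW)) _.
by vring.
Qed.

(** The roots that are not orthogonal to all the [e j] with [j] equal or linked to [i0] are
    orthogonal to the remaining roots; by irreducibility there are no remaining roots. *)
Lemma all_linked i0 i : i != i0 -> linked i0 i.
Proof.
move=> ii0.
pose C j := j = i0 \/ linked i0 j.
suff : C i by case=> // ieq; rewrite ieq eqxx in ii0.
have C_step j m y (s t : bool) : C j -> R y -> j != m ->
    y - ((-1) ^+ s *: e j + (-1) ^+ t *: e m) \in W -> C m.
  move=> Cj Ry jm yW; have lin : linked j m by exists y, s, t.
  have [->|mi0] := eqVneq m i0; first by left.
  right; have [<-//|ji0] := eqVneq j i0.
  case: Cj => [ji|lin0]; first by rewrite ji eqxx in ji0.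
  by apply: (linked_trans _ jm _ lin0 lin); rewrite eq_sym.
pose R1 := [set y | R y /\ exists j, C j /\ I (e j) y != 0].
pose R2 := [set y | R y /\ forall j, C j -> I (e j) y = 0].
have RU : R = R1 `|` R2.
  apply/seteqP; split=> [y Ry|y [[]|[]] //].
  have [h|h] := pselect (exists j, C j /\ I (e j) y != 0); first by left.
  by right; split=> // j Cj; apply/eqP/negPn/negP => nz; apply: h; exists j.
have R12 : R1 `&` R2 = set0.
  apply/seteqP; split=> [y [[_ [j [Cj jy]]] [_ y0]]|//].
  by rewrite y0 ?eqxx in jy.
have orth12 x y : R1 x -> R2 y -> I x y = 0.
  move=> [Rx [j [Cj jx]]] [Ry y0].
  case: (shape Rx) => [[s [m h]]|[s [m h]]|[s [t [m [n [mn h]]]]]];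
    rewrite (cong_l _ h) !bilE.
  - have [jm|jm] := eqVneq j m; first by rewrite -jm y0 ?mulr0.
    by move: jx; rewrite (cong_r _ h) !bilE orthE // !mulr0 eqxx.
  - have [jm|jm] := eqVneq j m; first by rewrite -jm y0 ?mulr0.
    by move: jx; rewrite (cong_r _ h) !bilE orthE // !mulr0 eqxx.
  - have [jm|jm] := eqVneq j m.
      rewrite jm in Cj.
      have Cn : C n := C_step _ _ _ _ _ Cj Rx mn h.
      by rewrite (y0 m) // (y0 n) // !mulr0 addr0.
    have [jn|jn] := eqVneq j n.
      rewrite jn in Cj; rewrite eq_sym in mn; rewrite (addrC (_ *: e m)) in h.
      have Cm : C m := C_step _ _ _ _ _ Cj Rx mn h.
      by rewrite (y0 m) // (y0 n) // !mulr0 addr0.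
    by move: jx; rewrite (cong_r _ h) !bilE !orthE // !mulr0 addr0 eqxx.
have [R1_0|R2_0] := root_irreducible rsR RU R12 orth12.
- have : R1 (e i0).
    by split=> //; exists i0; split; [left | rewrite normE].
  by rewrite R1_0.
- have := Re i; rewrite RU R2_0 setU0 => -[_ [j [Cj ji]]].
  have [<-//|ne] := eqVneq j i.
  by rewrite orthE ?eqxx in ji.
Qed.

(** Translating the members of the family along the radical makes their differences roots. *)
Lemma normalized_family (i0 : 'I_k) : exists f : 'I_k -> F,
  [/\ forall i, R (f i), forall i j, i != j -> R (f i - f j)
    & forall i, f i - e i \in W].
Proof.
have flip i y : R y -> R (y - (2 * I (e i) y / c) *: e i).
  by move=> Ry; apply: (root_reflect rsR) => //; rewrite normE; field.
have diff i : i != i0 -> exists2 y, R y & y - (e i - e i0) \in W.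
  move=> ii0; have i0i : i0 != i by rewrite eq_sym.
  have [y [s [t [Ry yW]]]] := all_linked ii0.
  have [y' Ry' yW'] : exists2 y', R y' & y' - ((-1) ^+ s *: e i0 + e i) \in W.
    case: t yW => yW; last by exists y => //; rewrite -[e i]scale1r.
    exists (y - (2 * I (e i) y / c) *: e i); first exact: flip.
    rewrite (cong_r _ yW) !bilE normE orthE // (_ : _ / c = - 2); last by field.
    by apply: memv_eq yW _; rewrite expr1; vring.
  case: s yW' {yW} => yW'; first by exists y' => //; apply: memv_eq yW' _; rewrite expr1; vring.
  exists (y' - (2 * I (e i0) y' / c) *: e i0); first exact: flip.
  rewrite (cong_r _ yW') !bilE normE orthE // (_ : _ / c = 2); last by field.
  by apply: memv_eq yW' _; vring.
have fam i : exists v, [/\ R v, v - e i \in W, i = i0 -> v = e i0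
    & i != i0 -> R (v - e i0)].
  have [->|ii0] := eqVneq i i0.
    by exists (e i0); split=> //; rewrite subrr mem0v.
  have [y Ry yW] := diff i ii0; have i0i : i0 != i by rewrite eq_sym.
  exists (e i0 + y); split=> //.
  - rewrite (_ : e i0 + y = e i0 - (-1) *: y); last by vring.
    apply: (root_reflect rsR) => //.
    by rewrite (cong_l _ yW) (cong_l y yW) (cong_r _ yW) !bilE !normE !orthE //; ring.
  - by apply: memv_eq yW _; vring.
  - by move=> ieq; rewrite ieq eqxx in ii0.
  - by rewrite addrC addKr.
have [f fP] := choice fam.
have f0 : f i0 = e i0 by case: (fP i0) => _ _ -> .
have Rdiff i : i != i0 -> R (f i - e i0) by case: (fP i).
have fe i : f i - e i \in W by case: (fP i).
exists f; split=> // [i|i j ij]; first by case: (fP i).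
have [ieq|ii0] := eqVneq i i0; have [jeq|ji0] := eqVneq j i0.
- by rewrite ieq jeq eqxx in ij.
- by rewrite ieq f0 -opprB; apply: (root_opp rsR); apply: Rdiff.
- by rewrite jeq f0; apply: Rdiff.
rewrite (_ : f i - f j = (f i - e i0) - 1 *: (f j - e i0)); last by vring.
apply: (root_reflect rsR); try exact: Rdiff.
have cong m : (f m - e i0) - (e m - e i0) \in W.
  by apply: memv_eq (fe m) _; vring.
rewrite (cong_l _ (cong j)) (cong_r _ (cong i)) (cong_l _ (cong j)) (cong_r _ (cong j)).
have [ji i0i i0j] : [/\ j != i, i0 != i & i0 != j] by rewrite !(eq_sym _ i) !(eq_sym i0).
by rewrite !bilE !normE !orthE //; ring.
Qed.

End Connectivity.
End RootFrames.

(** * Lattices in a real vector space *)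

Section Lattices.
Variables (K : realType) (F : vectType K).

Lemma int_gen_ind (A P : set F) : P 0 ->
  (forall x y, P x -> P y -> P (x - y)) -> A `<=` P -> int_gen A `<=` P.
Proof.
move=> P0 PB AP v [m [s [sA [u ->]]]].
have PN x : P x -> P (- x) by move=> Px; rewrite -sub0r; apply: PB.
have PD x y : P x -> P y -> P (x + y).
  by move=> Px Py; rewrite -[y]opprK; apply/PB/PN.
have PM x n : P x -> P (x *+ n).
  by move=> Px; elim: n => [|n IHn]; rewrite ?mulr0n // mulrS; apply: PD.
apply: (big_ind P) => // i _.
have : P s`_i by apply/AP/sA/mem_nth; rewrite size_tuple.
by case: (u i) => n Ps; [exact: PM | apply/PN/PM].
Qed.

Lemma sub_int_gen (A : set F) : A `<=` int_gen A.
Proof.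
move=> x Ax; exists 1%N, [tuple x]; split; first by move=> y; rewrite inE => /eqP ->.
by exists [ffun=> 1]; rewrite big_ord1 ffunE mulr1z.
Qed.

Section FullLattice.
Variable Q : set F.
Hypothesis latQ : full_lattice Q.

Lemma lattice0 : Q 0.
Proof.
case: latQ => m [s [_ ->]]; exists [ffun=> 0]; rewrite big1 // => i _.
by rewrite ffunE mulr0z.
Qed.

Lemma latticeB x y : Q x -> Q y -> Q (x - y).
Proof.
case: latQ => m [s [_ ->]] [u ->] [v ->]; exists [ffun i => u i - v i].
by rewrite -sumrB; apply: eq_bigr => i _; rewrite ffunE mulrzBr.
Qed.

Lemma latticeN x : Q x -> Q (- x).
Proof. by rewrite -sub0r; apply/latticeB/lattice0. Qed.

Lemma latticeD x y : Q x -> Q y -> Q (x + y).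
Proof. by move=> Qx /latticeN; rewrite -{2}[y]opprK; apply: latticeB. Qed.

Lemma lattice_sign (s : bool) x : Q x -> Q ((-1) ^+ s *: x).
Proof. by case: s; rewrite ?expr0 ?scale1r // expr1 scaleN1r; apply: latticeN. Qed.

Lemma latticeZ (n : int) x : Q x -> Q (n%:~R *: x).
Proof.
case: latQ => m [s [_ ->]] [u ->]; exists [ffun i => u i * n].
rewrite scaler_sumr; apply: eq_bigr => i _.
by rewrite ffunE scaler_int -mulrzA.
Qed.

(** For suitable coordinates [p] and [q] in a basis of the lattice, [d y] is the minor
    [a_p y_q - a_q y_p]. *)
Lemma lattice_functional a x : a != 0 -> x \notin <[a]>%VS ->
  exists d : F -> K, [/\ forall u v, d (u + v) = d u + d v,
    forall k u, d (k *: u) = k * d u, d a = 0, d x != 0 &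
    forall y, Q a -> Q y -> exists z : int, d y = z%:~R].
Proof.
move=> a0 xa; case: latQ => m [s [bas_s QE]].
have coordZ i k u : coord s i (k *: u) = k * coord s i u by exact: linearZ.
have expand y : y = \sum_i coord s i y *: s`_i by apply: coord_basis (memvf y).
have [p pa] : exists p, coord s p a != 0.
  apply: contrapT => /forallNP none; case/eqP: a0; rewrite (expand a) big1 // => i _.
  by have /negP/negPn/eqP -> := none i; rewrite scale0r.
pose r := coord s p x / coord s p a.
have [q qx] : exists q, coord s q (x - r *: a) != 0.
  apply: contrapT => /forallNP none; case/negP: xa; apply/vlineP; exists r.
  apply/eqP; rewrite -subr_eq0; apply/eqP; rewrite [LHS]expand big1 // => i _.
  by have /negP/negPn/eqP -> := none i; rewrite scale0r.
exists (fun y => coord s p a * coord s q y - coord s q a * coord s p y); split.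
- by move=> u v; rewrite !linearD /=; ring.
- by move=> k u; rewrite !coordZ; ring.
- by ring.
- apply: contra qx; rewrite subr_eq0 => /eqP h; rewrite linearB /= coordZ.
  apply/eqP/(mulfI pa); rewrite mulr0 mulrBr h /r; field.
  by [].
have int_coord i y : Q y -> exists z : int, coord s i y = z%:~R.
  rewrite QE => -[u ->]; exists (u i).
  rewrite -(coord_sum_free (fun j => (u j)%:~R) i (basis_free bas_s)).
  by congr (coord _ _ _); apply: eq_bigr => j _; rewrite scaler_int.
move=> y Qa Qy; have [z1 ->] := int_coord p a Qa; have [z2 ->] := int_coord q a Qa.
have [z3 ->] := int_coord p y Qy; have [z4 ->] := int_coord q y Qy.
by exists (z1 * z4 - z2 * z3); rewrite intrB !intrM.
Qed.

(** A primitive vector [a] of the lattice [Q] lying in a plane [W] is part of a basis of the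
    lattice vectors of [W], if these are not all multiples of [a]: the vector [b] is one at
    which an integral functional vanishing at [a] takes its least positive value. *)
Lemma lattice_basis (W : {vspace F}) a x : \dim W = 2%N -> a != 0 ->
  (forall y, Q y -> y \in <[a]>%VS -> exists n : int, y = n%:~R *: a) ->
  Q a -> a \in W -> Q x -> x \in W -> x \notin <[a]>%VS ->
  exists b, [/\ Q b, b \in W, b \notin <[a]>%VS &
    forall y, Q y -> y \in W -> exists m n : int, y = m%:~R *: a + n%:~R *: b].
Proof.
move=> dimW a0 prim Qa aW Qx xW xa.
have [d [dD dZ da dx dint]] := lattice_functional a0 xa.
(* over K, the vectors a and x span W, so that d only vanishes on W at multiples of a *)
have W_basis y : y \in W -> exists u v, y = u *: a + v *: x.
  have dimX : \dim (<[a]> + <[x]>)%VS = 2%N.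
    have x0 : x != 0 by apply: contra xa => /eqP ->; rewrite mem0v.
    have cap0 : (<[a]> :&: <[x]> = 0)%VS.
      apply/eqP; rewrite -subv0; apply/subvP => z; rewrite memv_cap memv0.
      move=> /andP[za /vlineP[k zk]]; have [k0|k0] := eqVneq k 0.
        by rewrite zk k0 scale0r.
      by case/negP: xa; rewrite -[x](scalerK k0) -zk memvZ.
    by rewrite (dimv_disjoint_sum cap0) !dim_vline a0 x0.
  have <- : (<[a]> + <[x]>)%VS = W.
    by apply/eqP; rewrite eqEdim subv_add -!memvE aW xW dimX dimW.
  by move=> /memv_addP[_ /vlineP[u ->] [_ /vlineP[v ->] ->]]; exists u, v.
pose P k := exists y, [/\ Q y, y \in W & d y = k.+1%:R].
have exP : exists k, `[< P k >].
  have [[[|n]|n] hz] := dint x Qa Qx; first by rewrite hz eqxx in dx.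
    by exists n; apply/asboolP; exists x.
  exists n; apply/asboolP; exists (- x); split; [exact: latticeN | by rewrite memvN |].
  by rewrite -scaleN1r dZ hz NegzE intrN mulrNN mul1r.
case: (ex_minnP exP) => k /asboolP[b [Qb bW db]] min.
have b_notin : b \notin <[a]>%VS.
  apply/negP => /vlineP[u bE]; move: db; rewrite bE dZ da mulr0 => /esym/eqP.
  by rewrite pnatr_eq0.
exists b; split=> // y Qy yW.
have [z dy] := dint y Qa Qy.
pose q := (z %/ k.+1)%Z; pose r := (z %% k.+1)%Z.
have Qr : Q (y - q%:~R *: b) by apply/latticeB/latticeZ.
have rW : y - q%:~R *: b \in W by rewrite memvB ?memvZ.
have dr : d (y - q%:~R *: b) = r%:~R.
  by rewrite -scaleNr dD dZ dy db {1}(divz_eq z k.+1) intrD intrM; ring.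
have r0 : r = 0.
  have r_ge0 : 0 <= r by rewrite modz_ge0.
  have r_lt : r < k.+1 by rewrite ltz_pmod.
  case rE : r r_ge0 r_lt dr => [[//|n]|//] _ nk dr.
  have /min : `[< P n >] by apply/asboolP; exists (y - q%:~R *: b).
  by move: nk; rewrite ltz_nat ltnS => nk; rewrite leqNgt nk.
have [u [v yE]] := W_basis _ rW.
have v0 : v = 0.
  move: dr; rewrite r0 yE dD !dZ da mulr0 add0r => /eqP; rewrite mulf_eq0 (negPf dx) orbF.
  by move/eqP.
have ra : y - q%:~R *: b \in <[a]>%VS.
  by rewrite yE v0 scale0r addr0 memvZ // memv_line.
have [n nE] := prim _ Qr ra.
by exists n, q; rewrite -nE subrK.
Qed.

End FullLattice.
End Lattices.

(** * Frames adapted to a marked elliptic root system *)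

(** Coordinates in which a root system has the listed form: orthogonal short roots [f i] of
    norm [c], whose differences are roots, and vectors [a], [b] of the radical,
    with [a] spanning the marking, that form a basis of the radical part of the root
    lattice. Every root is a short, long or middle root of type [BC_l]
    translated by an integral combination of [a] and [b]. *)
Record adapted_frame (K : realType) (F : vectType K) (I : {symmetric F})
    (R : set F) (G : {vspace F}) l (c : K) (f : 'I_l -> F) (a b : F) : Prop :=
 AdaptedFrame {
  af_norm : 0 < c;
  af_orth : orthogonal_family I c f;
  af_short : forall i, R (f i);
  af_middle : forall i j, i != j -> R (f i - f j);
  af_rad_a : forall y, I a y = 0;
  af_rad_b : forall y, I b y = 0;
  af_free : forall u v : K, u *: a + v *: b = 0 -> u = 0 /\ v = 0;
  af_marking : G = <[a]>%VS;
  af_shape : forall y, R y -> exists (m n : int),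
    let p := m%:~R *: a + n%:~R *: b in
    [\/ exists (s : bool) i, y = (-1) ^+ s *: f i + p,
        exists (s : bool) i, y = (-1) ^+ s *: (2 *: f i) + p
      | exists (s t : bool) i j, i != j /\
          y = (-1) ^+ s *: f i + (-1) ^+ t *: f j + p];
  af_gen : forall m n : int, int_gen R (m%:~R *: a + n%:~R *: b) }.

Lemma mem_span_root (K : realType) (F : vectType K) (R : set F) (V : {vspace F}) :
  full_lattice (int_gen R) -> (forall x, R x -> x \in V) -> V = fullv.
Proof.
move=> [m [s [bas_s QE]]] RV; apply/eqP; rewrite eqEsubv subvf /=.
rewrite -(span_basis bas_s); apply/span_subvP => x xs.
have : int_gen R x.
  rewrite QE; have [i im <-] := nthP 0 xs; rewrite size_tuple in im.
  exists [ffun j => (j == Ordinal im)%:R]; rewrite (bigD1 (Ordinal im)) //= big1.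
    by rewrite ffunE eqxx mulr1z addr0.
  by move=> j /negPf ji; rewrite ffunE ji mulr0z.
apply: (@int_gen_ind _ _ R (fun y => y \in V)) => [|y z|//].
- exact: mem0v.
- exact: memvB.
Qed.

(** If the images of the roots [x] and [y] are proportional, the ratio being [k], then [2 k]
    and [2 / k] are integers, and [k] is not [1] or [-1]: hence one of the roots is
    congruent to the double of the other, up to sign. *)
Lemma nonreduced_pair (K : realType) (F : vectType K) (I : {symmetric F})
    (R : set F) (G : {vspace F}) :
  root_system I R -> (forall x y, x \in G -> I x y = 0) ->
  ~ reduced (quo_roots R G) ->
  exists x y, [/\ R x, R y & y - 2 *: x \in G].
Proof.
move=> rsR radG nred.
have quo_eq x y : quo_map G x = quo_map G y -> x - y \in G.
  by move=> h; rewrite -(lker_quo_map G) memv_ker linearB /= h subrr.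
have [q [k [[x Rx qx] [y Ry ky] nk]]] : exists q (k : K),
    [/\ quo_roots R G q, quo_roots R G (k *: q) & ~ (k = 1 \/ k = -1)].
  apply: contrapT => none; apply: nred => q k Rq Rkq; apply: contrapT => nk.
  by apply: none; exists q, k.
have yG : y - k *: x \in G by apply: quo_eq; rewrite ky -qx linearZ.
have Ixy : I x y = k * I x x.
  by rewrite bilC -[y](subrK (k *: x)) bilDl radG // add0r bilZl.
have Iyy : I y y = k * (k * I x x).
  rewrite -[y in I y _](subrK (k *: x)) bilDl radG // add0r bilZl Ixy //.
have x0 := root_nonisotropic rsR Rx; have y0 := root_nonisotropic rsR Ry.
have k0 : k != 0 by apply: contraNneq y0 => k0; rewrite Iyy k0 mul0r.
have root_int u v : R u -> R v -> exists n : int, 2 * I u v = n%:~R * I u u.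
  exact: root_pairing_int.
have [n hn] := root_int _ _ Rx Ry; have [m hm] := root_int _ _ Ry Rx.
rewrite Ixy mulrA in hn; have {}hn := mulIf x0 hn.
rewrite bilC Ixy Iyy !mulrA in hm; have {}hm := mulIf x0 hm.
have mk : m%:~R * k = 2 by apply: (mulIf k0); rewrite -hm.
have mn : m * n = 4.
  by apply/eqP; rewrite -(eqr_int K) intrM -hn mulrCA mk; apply/eqP; ring.
have n_le4 : (`|n| <= 4)%N.
  by have := dvdz_mull m (dvdzz n); rewrite mn dvdzE => /dvdn_leq; lia.
have [n1|[n1|[n2|[n2|[n4|n4]]]]] :
    n = 1 \/ n = -1 \/ n = 2 \/ n = -2 \/ n = 4 \/ n = -4.
  have : n = 0 \/ n = 1 \/ n = -1 \/ n = 2 \/ n = -2 \/ n = 3 \/ n = -3 \/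
    n = 4 \/ n = -4 by lia.
  by case=> [|[|[|[|[|[|[|[|]]]]]]]] nE; rewrite nE in mn *; lia.
- exists y, x; split=> //; have kE : k = 1 / 2 by move: hn; rewrite n1; lra.
  by apply: memv_eq (memvZ (- 2) yG) _; apply: vcoord_inj => ?; rewrite kE !vcoordE; field.
- exists (- y), x; split=> //; first exact: (root_opp rsR).
  have kE : k = - (1 / 2) by move: hn; rewrite n1; lra.
  by apply: memv_eq (memvZ 2 yG) _; apply: vcoord_inj => ?; rewrite kE !vcoordE; field.
- by case: nk; left; move: hn; rewrite n2; lra.
- by case: nk; right; move: hn; rewrite n2; lra.
- exists x, y; split=> //; have kE : k = 2 by move: hn; rewrite n4; lra.
  by apply: memv_eq yG _; rewrite kE.
- exists (- x), y; split=> //; first exact: (root_opp rsR).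
  have kE : k = - 2 by move: hn; rewrite n4; lra.
  by apply: memv_eq yG _; rewrite kE; vring.
Qed.

Theorem adapted_frame_exists (K : realType) (F : vectType K)
    (I : {symmetric F}) l (R : set F) (G : {vspace F}) :
  marked_elliptic I l R G -> ~ reduced (quo_roots R G) ->
  exists c (f : 'I_l -> F) a b, adapted_frame I R G c f a b /\
    exists x y, [/\ R x, R y, I x x = c & y - 2 *: x \in G].
Proof.
move=> [rsR sig dimG GradI rankG] nred.
have [W [dimW dimF radW bil_ge0 bil_eq0]] := elliptic_radical sig.
have latQ := root_lattice rsR.
have radG x y : x \in G -> I x y = 0 by move=> xG; apply: GradI.
have GW : (G <= W)%VS by apply/subvP => x xG; apply: bil_eq0; apply: radG.
have [x0 [y0 [Rx0 Ry0 yx0]]] := nonreduced_pair rsR radG nred.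
pose c := I x0 x0.
have c_gt0 : 0 < c := root_norm_gt0 bil_ge0 rsR Rx0.
have Dx0 : doubled I W R c x0.
  by split=> //; exists y0 => //; apply: (subvP GW).
have [k [e [De orth max]]] := maximal_doubled_family I W R c_gt0.
have [i0 _] := max x0 Dx0.
have k_gt0 : (0 < k)%N by apply: leq_ltn_trans (ltn_ord i0).
have shape := doubled_family_shape radW bil_ge0 bil_eq0 rsR c_gt0 De orth max k_gt0.
have Re i : R (e i) by case: (De i).
have [f [Rf Rff fe]] := normalized_family radW rsR c_gt0 Re orth shape i0.
have f_orth : orthogonal_family I c f.
  move=> i j; rewrite -orth.
  by rewrite (bil_congl radW _ (fe i)) (bil_congr radW _ (fe j)).
have f_shape y : R y -> BC_shape W f y.
  have tr (u : K) i : u *: (e i - f i) \in W by rewrite memvZ // -opprB memvN.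
  move=> /shape[[s [i h]]|[s [i h]]|[s [t [i [j [ij h]]]]]].
  - constructor 1; exists s, i; apply: memv_eq (memvD h (tr ((-1) ^+ s) i)) _.
    by vring.
  - constructor 2; exists s, i; apply: memv_eq (memvD h (tr (2 * (-1) ^+ s) i)) _.
    by vring.
  - constructor 3; exists s, t, i, j; split=> //.
    apply: memv_eq (memvD h (memvD (tr ((-1) ^+ s) i) (tr ((-1) ^+ t) j))) _.
    by vring.
pose V := <<[seq f i | i : 'I_k]>>%VS.
have fV i : f i \in V by apply: memv_span; apply: map_f; rewrite mem_enum.
have dimV : \dim V = k.
  by have /eqP -> := orthogonal_family_free c_gt0 f_orth; rewrite size_map size_enum_ord.
have capVW : (V :&: W = 0)%VS := orthogonal_family_cap radW c_gt0 f_orth.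
have shapeVW y : R y -> exists v w, [/\ v \in V, w \in W, y = v + w & int_gen R v].
  have split v : v \in V -> int_gen R v -> y - v \in W ->
      exists v w, [/\ v \in V, w \in W, y = v + w & int_gen R v].
    by move=> vV Qv yv; exists v, (y - v); split; rewrite // addrC subrK.
  have Qf i : int_gen R (f i) by apply: sub_int_gen.
  move=> Ry; case: (f_shape y Ry) => [[s [i h]]|[s [i h]]|[s [t [i [j [ij h]]]]]].
  - by apply: split h; [rewrite memvZ | apply: lattice_sign].
  - apply: split h; first by rewrite !memvZ.
    by apply: lattice_sign => //; rewrite scaler_nat mulr2n; apply: latticeD.
  - apply: split h; first by rewrite memvD ?memvZ.
    by apply: latticeD => //; apply: lattice_sign.
(* the roots span F, which is therefore the sum of V and W *)
have kl : k = l.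
  have VWfull : (V + W)%VS = fullv.
    apply: (mem_span_root latQ) => y /shapeVW[v [w [vV wW -> _]]].
    exact: memv_add.
  have := dimv_disjoint_sum capVW; rewrite VWfull dimF dimV dimW.
  by move/eqP; rewrite eqn_add2r => /eqP.
clearbody V; rewrite kl in dimV; subst k.
have [a [Qa Ga Gprim]] : exists a, [/\ int_gen R a, G = <[a]>%VS &
    forall y, int_gen R y -> y \in G -> exists n : int, y = n%:~R *: a].
  case: rankG => s [s_free GQ]; exists (tnth s ord0).
  have sGQ : ([set` G] `&` int_gen R) (tnth s ord0).
    rewrite GQ; exists [ffun=> 1]; rewrite big_ord1 ffunE mulr1z.
    by rewrite (tnth_nth 0).
  have s0 : tnth s ord0 != 0.
    apply/eqP => s0; have /(_ (fun=> 1)) := s_free; rewrite big_ord1 mulr1z.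
    by rewrite -(tnth_nth _ _ ord0) s0 => /(_ erefl ord0).
  case: sGQ => sG Qs; split=> //.
    apply/esym/eqP; rewrite eqEdim -memvE sG dimG dim_vline s0 //.
  move=> y Qy yG; have : ([set` G] `&` int_gen R) y by [].
  rewrite GQ => -[u]; rewrite big_ord1 => ->; exists (u ord0).
  by rewrite scaler_int (tnth_nth 0).
have a0 : a != 0 by move: dimG; rewrite Ga dim_vline; case: eqP.
have aW : a \in W by apply: (subvP GW); rewrite Ga memv_line.
(* otherwise the roots would lie in V + G, a hyperplane *)
have [x [Qx xW xa]] : exists x, [/\ int_gen R x, x \in W & x \notin <[a]>%VS].
  apply: contrapT => none.
  have VGfull : (V + G)%VS = fullv.
    apply: (mem_span_root latQ) => y Ry; have [v [w [vV wW yE Qv]]] := shapeVW y Ry.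
    rewrite yE memv_add // Ga; apply/negPn/negP => wa; apply: none; exists w; split=> //.
    have -> : w = y - v by rewrite yE addrAC subrr add0r.
    by apply: latticeB => //; apply: sub_int_gen.
  have := dimv_add_leqif V G => -[h _]; move: h.
  by rewrite VGfull dimF dimV dimG addn1 addn2 ltnn.
rewrite Ga in Gprim.
have [b [Qb bW ba ab_basis]] := lattice_basis latQ dimW a0 Gprim Qa aW Qx xW xa.
exists c, f, a, b; split; last by exists x0, y0.
split=> //.
- exact: radW.
- exact: radW.
- move=> u v uv; have v0 : v = 0.
    apply/eqP/negPn/negP => v0; case/negP: ba; apply/vlineP; exists (- (v^-1 * u)).
    apply: (scalerI v0); rewrite scalerA mulrN mulrA divff // mul1r scaleNr.
    by apply/eqP; rewrite -addr_eq0 addrC uv.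
  split=> //; move: uv; rewrite v0 scale0r addr0 => /eqP.
  by rewrite scaler_eq0 (negPf a0) orbF => /eqP.
- have radical_part y v : R y -> int_gen R v -> y - v \in W ->
      exists m n : int, y = v + (m%:~R *: a + n%:~R *: b).
    move=> Ry Qv yv; have Qyv : int_gen R (y - v).
      by apply: latticeB => //; apply: sub_int_gen.
    by have [m [n h]] := ab_basis _ Qyv yv; exists m, n; rewrite -h addrC subrK.
  have Qf i : int_gen R (f i) by apply: sub_int_gen.
  move=> y Ry; case: (f_shape y Ry) => [[s [i h]]|[s [i h]]|[s [t [i [j [ij h]]]]]].
  + have [m [n yE]] := radical_part _ _ Ry (lattice_sign latQ s (Qf i)) h.
    by exists m, n; constructor 1; exists s, i.
  + have Q2 : int_gen R (2 *: f i) by rewrite scaler_nat mulr2n; apply: latticeD.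
    have [m [n yE]] := radical_part _ _ Ry (lattice_sign latQ s Q2) h.
    by exists m, n; constructor 2; exists s, i.
  + have Q2 := latticeD latQ (lattice_sign latQ s (Qf i)) (lattice_sign latQ t (Qf j)).
    have [m [n yE]] := radical_part _ _ Ry Q2 h.
    by exists m, n; constructor 3; exists s, t, i, j.
- by move=> m n; apply: latticeD => //; apply: latticeZ.
Qed.

(** * Classification of the translation sets *)

Lemma lat_starE (m n : int) :
  lat_star (m, n) <-> (m %% 2 = 1)%Z \/ (n %% 2 = 1)%Z.
Proof.
rewrite /lat_star /=; split.
- move=> h; case: (eqVneq (m %% 2)%Z 1) => [->|nm]; first by left.
  case: (eqVneq (n %% 2)%Z 1) => [->|nn]; first by right.
  move: h; rewrite -modzMm.
  have -> : ((m - 1) %% 2 = 1)%Z by lia.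
  have -> : ((n - 1) %% 2 = 1)%Z by lia.
  by [].
- rewrite -modzMm; case=> h.
  + have -> : ((m - 1) %% 2 = 0)%Z by lia.
    by rewrite mul0r.
  + have -> : ((n - 1) %% 2 = 0)%Z by lia.
    by rewrite mulr0.
Qed.

Lemma lat_oddE (k m n : int) :
  lat_odd k (m, n) <-> (m %% 2 = 1)%Z /\ (n %% k = 0)%Z.
Proof.
split=> [[i _ [j _ [<- <-]]]|[hm hn]].
  by split; [lia | rewrite mulrC modzMl].
exists (m %/ 2)%Z => //; exists (n %/ k)%Z => //.
congr (_, _); first by lia.
by rewrite [RHS](divz_eq n k) hn addr0 mulrC.
Qed.

Lemma lat_a2bE (m n : int) : lat_a2b (m, n) <-> (n %% 2 = 0)%Z.
Proof.
split=> [[i _ [j _ [_ <-]]]|hn]; first by lia.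
by exists m => //; exists (n %/ 2)%Z => //; congr (_, _); lia.
Qed.

Lemma lat_scaleE (k m n : int) :
  lat_scale k (m, n) <-> (m %% k = 0)%Z /\ (n %% k = 0)%Z.
Proof.
split=> [[i _ [j _ [<- <-]]]|[hm hn]].
  by rewrite ![k * _]mulrC !modzMl.
exists (m %/ k)%Z => //; exists (n %/ k)%Z => //.
by rewrite [in RHS](divz_eq n k) [in RHS](divz_eq m k) hm hn !addr0 ![k * _]mulrC.
Qed.

(** The description of the subset [A] of [Z a + Z b] by coordinates in the basis
    [a, b + k a], after the origin has been moved to [t]. *)
Definition lat_change (k : int) (t : int * int) (A : set (int * int)) :
  set (int * int) := [set p | A (p.1 + k * p.2 + t.1, p.2 + t.2)].

(** The properties that [S], [L] and [E] inherit from the root system: [S] generates the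
    lattice, which is tested modulo [2] by the functionals [c m + d n]; the three sets are stable
    under the reflections; the root system is reduced, but some long root is congruent to
    twice a short root modulo the marking. The set [L] is relevant only in rank at
    least [2], which is what [rank2] stands for. *)
Record translation_sets (rank2 : Prop) (S L E : set (int * int)) : Prop :=
 TranslationSets {
  ts_S0 : S (0, 0);
  ts_S_per : forall m n i j, S (m, n) -> S (m + 2 * i, n + 2 * j);
  ts_S_gen : forall c d : int, (c %% 2 = 1 \/ d %% 2 = 1)%Z ->
    exists m n, S (m, n) /\ ((c * m + d * n) %% 2 = 1)%Z;
  ts_E_per : forall m n i j, E (m, n) -> E (m + 4 * i, n + 4 * j);
  ts_E_opp : forall m n, E (m, n) -> E (- m, - n);
  ts_EE : forall m n p q, E (m, n) -> E (p, q) -> E (2 * m - p, 2 * n - q);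
  ts_SE : forall m n p q, S (m, n) -> E (p, q) -> S (m + p, n + q);
  ts_reduced : forall m n, S (m, n) -> ~ E (2 * m, 2 * n);
  ts_nonreduced : exists m n p, S (m, n) /\ E (p, 2 * n);
  ts_L0 : rank2 -> L (0, 0);
  ts_L_per : rank2 -> forall m n i j, L (m, n) -> L (m + 2 * i, n + 2 * j);
  ts_SL : rank2 -> forall m n p q, S (m, n) -> L (p, q) -> S (m + p, n + q);
  ts_LE : rank2 -> forall m n p q, L (m, n) -> E (p, q) -> L (m + p, n + q);
  ts_EL : rank2 -> forall m n p q, E (m, n) -> L (p, q) ->
    E (m + 2 * p, n + 2 * q) }.

(** The six triples of translation sets. *)
Definition listed_type (rank2 : Prop) (S L E : set (int * int)) : Prop :=
     (S, L, E) = (lat_all, lat_all, lat_odd 1)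
  \/ (S, L, E) = (lat_all, lat_all, lat_star)
  \/ (S, L, E) = (lat_all, lat_a2b, lat_odd 4)
  \/ (S, L, E) = (lat_star, lat_scale 2, lat_scale 4)
  \/ (S, L, E) = (lat_all, lat_a2b, lat_odd 2)
  \/ (rank2 /\ (S, L, E) = (lat_all, lat_all, lat_odd 2)).

Lemma periodic_mod (d : int) (A : set (int * int)) :
  (forall m n i j, A (m, n) -> A (m + d * i, n + d * j)) ->
  forall m n p q, (m %% d = p %% d)%Z -> (n %% d = q %% d)%Z ->
    A (m, n) -> A (p, q).
Proof.
have red (x y : int) : (x %% d = y %% d)%Z -> x + d * (divz y d - divz x d) = y.
  move=> h; rewrite [RHS](divz_eq y d) -h [X in X + _ = _](divz_eq x d); ring.
move=> perA m n p q hm hn Amn.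
by rewrite -(red m p hm) -(red n q hn); apply: perA.
Qed.

Lemma int_pair_set_eq (A B : set (int * int)) :
  (forall m n, A (m, n) <-> B (m, n)) -> A = B.
Proof. by move=> h; apply/funext => -[m n]; apply/propext. Qed.

Section TranslationSetsClassification.
Variables (rank2 : Prop) (S L E : set (int * int)).
Hypothesis ts : translation_sets rank2 S L E.

Let S_mod := periodic_mod (ts_S_per ts).
Let E_mod := periodic_mod (ts_E_per ts).
Let L_mod r2 := periodic_mod (ts_L_per ts r2).

(** The triple becomes a listed one when [b] is replaced by [b + k a] and the vector [e] from which
    the translations of short roots are counted by [e + t]. Those of long roots are then
    counted from [2 e + 2 t], those of differences of short roots as before. *)
Definition listed_up_to_change : Prop :=
  exists k t S' L' E', [/\ lat_change k t S = S',
    rank2 -> lat_change k (0, 0) L = L',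
    lat_change k (2 * t.1, 2 * t.2) E = E' & listed_type rank2 S' L' E'].

(** If a class modulo [2] is not in [S], then the other three are, since [S] contains [0] and
    generates. Hence only the zero class stabilizes [S], so that [E] and [L] are contained
    in it, and [E] consists of the doubles of the missing class. The origin is moved
    to this class, which produces the type [BC_l^(4,4)*]. *)
Lemma classify_star z1 z2 : ~ S (z1, z2) -> listed_up_to_change.
Proof.
move=> nS.
have S_odd c d : (c %% 2 = 1 \/ d %% 2 = 1)%Z -> exists m n,
    [/\ S (m, n), ((c * m + d * n) %% 2 = 1)%Z, m = 0 \/ m = 1 & n = 0 \/ n = 1].
  move=> cd; have [m [n [Smn h]]] := ts_S_gen ts cd.
  exists (m %% 2)%Z, (n %% 2)%Z; split; [|  | lia | lia].
    by apply: S_mod Smn; lia.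
  rewrite -h -modzDm -[in RHS]modzDm -(modzMm c m) -(modzMm d n).
  by rewrite -(modzMm c (m %% 2)%Z) -(modzMm d (n %% 2)%Z) !modz_mod.
have [m1 [n1 [S1 h1 p1 q1]]] := S_odd 1 0 (or_introl erefl).
have [m2 [n2 [S2 h2 p2 q2]]] := S_odd 0 1 (or_intror erefl).
have [m3 [n3 [S3 h3 p3 q3]]] := S_odd 1 1 (or_introl erefl).
have S00 := ts_S0 ts.
(* no functional modulo 2 vanishes on S, which therefore contains two nonzero classes *)
pose two_of_three := (S (1, 0) /\ S (0, 1)) \/ (S (1, 0) /\ S (1, 1))
   \/ (S (0, 1) /\ S (1, 1)).
have tot : two_of_three.
  move: S1 S2 S3 h1 h2 h3; rewrite /two_of_three.
  by case: p1 => ->; case: q1 => ->; case: p2 => ->; case: q2 => ->;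
    case: p3 => ->; case: q3 => -> //; tauto.
have mod01 (m : int) : (m %% 2 = 0)%Z \/ (m %% 2 = 1)%Z by lia.
have S_red m n : S (m, n) <-> S ((m %% 2)%Z, (n %% 2)%Z).
  by split; apply: S_mod; rewrite modz_mod.
move: nS; rewrite S_red => nS.
have Sz m n : S (m, n) <-> ~ ((m - z1) %% 2 = 0 /\ (n - z2) %% 2 = 0)%Z.
  split=> [Smn [hm hn]|].
    by apply: nS; rewrite -S_red; apply: S_mod Smn; lia.
  rewrite S_red; move: tot nS; rewrite /two_of_three.
  case: (mod01 m) => hm; case: (mod01 n) => hn; case: (mod01 z1) => hz1;
    case: (mod01 z2) => hz2; rewrite hm hn hz1 hz2;
    try by [move=> _ _ h; exfalso; apply: h; lia];
    by move: S00; clear; tauto.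
have e11 : ((1 + 1 : int) %% 2 = 0)%Z by [].
have e01 : ((0 + 1 : int) %% 2 = 1)%Z by [].
have e10 : ((1 + 0 : int) %% 2 = 1)%Z by [].
have e00 : ((0 + 0 : int) %% 2 = 0)%Z by [].
(* only the zero class modulo 2 stabilizes S *)
have SS_even p q : (forall m n, S (m, n) -> S (m + p, n + q)) ->
    (p %% 2 = 0 /\ q %% 2 = 0)%Z.
  move=> h.
  have h' m n : S (m, n) -> S (((m + (p %% 2)%Z) %% 2)%Z, ((n + (q %% 2)%Z) %% 2)%Z).
    by move=> /h /(S_red _ _).1; rewrite !modzDmr.
  move: (h' 0 0) (h' 1 0) (h' 0 1) (h' 1 1) tot nS; rewrite /two_of_three.
  case: (mod01 p) => hp; case: (mod01 q) => hq; rewrite hp hq; first by [];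
  case: (mod01 z1) => hz1; case: (mod01 z2) => hz2; rewrite hz1 hz2;
  rewrite !(e11, e10, e01, e00); move: S00; clear; tauto.
have E_even p q : E (p, q) -> (p %% 2 = 0 /\ q %% 2 = 0)%Z.
  by move=> Epq; apply: SS_even => m n Smn; apply: (ts_SE ts).
have E_double m n : E (2 * m, 2 * n) -> ((m - z1) %% 2 = 0 /\ (n - z2) %% 2 = 0)%Z.
  by move=> Emn; apply: contrapT => /Sz /(ts_reduced ts); apply.
have Ez m n : E (m, n) <->
    ((m - 2 * z1) %% 4 = 0 /\ (n - 2 * z2) %% 4 = 0)%Z.
  split=> [Emn|[hm hn]].
    have [hm hn] := E_even _ _ Emn.
    move: Emn; have -> : m = 2 * (divz m 2) by lia.
    have -> : n = 2 * (divz n 2) by lia.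
    by move=> /E_double; lia.
  have [_ [n0 [p [_ Ep]]]] := ts_nonreduced ts.
  have [hp _] := E_even _ _ Ep.
  move: (Ep); have -> : p = 2 * (divz p 2) by lia.
  by move=> /E_double ?; apply: E_mod Ep; lia.
exists 0, (z1, z2), lat_star, (lat_scale 2), (lat_scale 4); split.
- apply: int_pair_set_eq => m n; rewrite /lat_change /mkset /= lat_starE Sz; lia.
- move=> r2; apply: int_pair_set_eq => m n; rewrite lat_scaleE /lat_change /mkset /=.
  have -> : (m + 0 * n + 0, n + 0) = (m, n) by congr (_, _); ring.
  split=> [Lmn|[hm hn]].
    by apply: SS_even => p q Spq; apply: (ts_SL ts).
  by apply: (L_mod r2 _ _ (ts_L0 ts r2)); lia.
- apply: int_pair_set_eq => m n; rewrite /lat_change /mkset /= lat_scaleE Ez; lia.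
- by rewrite /listed_type; tauto.
Qed.

(** If [S] is the whole lattice, then [E] contains no even class, but contains some [p a + q b] with
    [p] odd and [q] even, and is therefore stable under [2 a]. Either [E] is stable under
    [2 b] as well and is a union of nonzero classes modulo [2], or only even
    multiples of [b] occur in [E] and [L]; then [E] is determined by its intersection
    with [{a, a + 2 b}]. *)
Lemma classify_full : (forall m n, S (m, n)) -> listed_up_to_change.
Proof.
move=> Sall.
have Snot m n : E (m, n) -> (m %% 2 = 1 \/ n %% 2 = 1)%Z.
  move=> Emn; apply: contrapT => h; apply: (ts_reduced ts (Sall (divz m 2) (divz n 2))).
  by apply: E_mod Emn; lia.
have [_ [n0 [p0 [_ Ep]]]] := ts_nonreduced ts.
have hp := Snot _ _ Ep.
have E_shift m n p q : E (m, n) -> E (p, q) -> E (p + 2 * m, q + 2 * n).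
  move=> Emn /(ts_E_opp ts) Epq.
  by have := ts_EE ts Emn Epq; rewrite !opprK !(addrC (2 * _)).
have E_2a m n : E (m, n) -> E (m + 2, n).
  by move=> /(E_shift _ _ _ _ Ep); apply: E_mod; lia.
have L_E m n : rank2 -> E (m, n) -> L (m, n).
  by move=> r2 Emn; have := ts_LE ts r2 (ts_L0 ts r2) Emn; rewrite !add0r.
have S_eq k t : lat_change k t S = lat_all.
  by apply: int_pair_set_eq => m n; split=> // _; apply: Sall.
pose E_2b := forall m n, E (m, n) -> E (m, n + 2).
have [[E2b Lall]|[Eeven Leven]] :
    (E_2b /\ (rank2 -> forall m n, L (m, n))) \/
    ((forall m n, E (m, n) -> (n %% 2 = 0)%Z) /\
     (rank2 -> forall m n, L (m, n) <-> (n %% 2 = 0)%Z)).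
  have [r2|nr2] := pselect rank2; last first.
    have [[m [n [Emn hn]]]|none] :=
        pselect (exists m n, E (m, n) /\ (n %% 2 = 1)%Z).
      left; split=> // p q Epq; have := E_shift _ _ _ _ Emn Epq.
      have [hm|hm] : (m %% 2 = 0 \/ m %% 2 = 1)%Z by lia.
        by apply: E_mod; lia.
      by move/E_2a; apply: E_mod; lia.
    by right; split=> // m n Emn; apply: contrapT => hn; apply: none; exists m, n; split=> //; lia.
  have L10 : L (1, 0) by apply: (L_mod r2 _ _ (L_E _ _ r2 Ep)); lia.
  have [[m [n [Lmn hn]]]|none] :=
      pselect (exists m n, L (m, n) /\ (n %% 2 = 1)%Z).
    left; split=> [p q Epq|_ p q].
      have := ts_EL ts r2 Epq Lmn.
      have [hm|hm] : (m %% 2 = 0 \/ m %% 2 = 1)%Z by lia.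
        by apply: E_mod; lia.
      by move/E_2a; apply: E_mod; lia.
    have Lmn' : L (m + p0, n + 2 * n0) := ts_LE ts r2 Lmn Ep.
    have [hq|hq] : (q %% 2 = 0 \/ q %% 2 = 1)%Z by lia.
      have [h|h] : (p %% 2 = 0 \/ p %% 2 = 1)%Z by lia.
        by apply: (L_mod r2 _ _ (ts_L0 ts r2)); lia.
      by apply: (L_mod r2 _ _ L10); lia.
    have [h|h] : ((p - m) %% 2 = 0 \/ (p - m) %% 2 = 1)%Z by lia.
      by apply: (L_mod r2 _ _ Lmn); lia.
    by apply: (L_mod r2 _ _ Lmn'); lia.
  have Leven m n : L (m, n) -> (n %% 2 = 0)%Z.
    by move=> Lmn; apply: contrapT => hn; apply: none; exists m, n; split=> //; lia.
  right; split=> [m n /(L_E _ _ r2)|_ m n]; first exact: Leven.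
  split=> [|hn]; first exact: Leven.
  have [h|h] : (m %% 2 = 0 \/ m %% 2 = 1)%Z by lia.
    by apply: (L_mod r2 _ _ (ts_L0 ts r2)); lia.
  by apply: (L_mod r2 _ _ L10); lia.
- have E_mod2 m n p q : (m %% 2 = p %% 2)%Z -> (n %% 2 = q %% 2)%Z ->
      E (m, n) -> E (p, q).
    move=> hm hn Emn.
    have : E (m, q).
      have [h|h] : (n %% 4 = q %% 4 \/ (n + 2) %% 4 = q %% 4)%Z by lia.
        by apply: E_mod Emn.
      by apply: E_mod (E2b _ _ Emn).
    have [h|h] : (m %% 4 = p %% 4 \/ (m + 2) %% 4 = p %% 4)%Z by lia.
      by apply: E_mod.
    by move/E_2a; apply: E_mod.
  have E10 : E (1, 0) by apply: E_mod2 Ep; lia.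
  have L_eq k : rank2 -> lat_change k (0, 0) L = lat_all.
    by move=> r2; apply: int_pair_set_eq => m n; split=> // _; apply: Lall.
  have E_red m n : E (m, n) <->
      ((m %% 2 = 1 /\ n %% 2 = 0) \/ (m %% 2 = 0 /\ n %% 2 = 1 /\ E (0, 1)) \/
       (m %% 2 = 1 /\ n %% 2 = 1 /\ E (1, 1)))%Z.
    split=> [Emn|[[hm hn]|[[hm [hn E01]]|[hm [hn E11]]]]]; last first.
    + by apply: E_mod2 E11; lia.
    + by apply: E_mod2 E01; lia.
    + by apply: E_mod2 E10; lia.
    have hmn := Snot _ _ Emn.
    have [h|h] : (n %% 2 = 0 \/ n %% 2 = 1)%Z by lia.
      by left; lia.
    have [h'|h'] : (m %% 2 = 0 \/ m %% 2 = 1)%Z by lia.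
      by right; left; split=> //; split=> //; apply: E_mod2 Emn; lia.
    by right; right; split=> //; split=> //; apply: E_mod2 Emn; lia.
  (* E contains a; it remains to know whether it contains b and a + b *)
  have [E01|nE01] := pselect (E (0, 1)); have [E11|nE11] := pselect (E (1, 1)).
  + exists 0, (0, 0), lat_all, lat_all, lat_star; split=> //.
    * exact: L_eq.
    * apply: int_pair_set_eq => m n; rewrite lat_starE /lat_change /mkset /= E_red
      (propT E01) (propT E11); lia.
    * by rewrite /listed_type; tauto.
  + (* E contains b but not a + b: pass to the basis a, a + b *)
    exists 1, (0, 0), lat_all, lat_all, (lat_odd 1); split=> //.
    * exact: L_eq.
    * apply: int_pair_set_eq => m n; rewrite lat_oddE /lat_change /mkset /= E_red
      (propT E01) (propF nE11); lia.
    * by rewrite /listed_type; tauto.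
  + exists 0, (0, 0), lat_all, lat_all, (lat_odd 1); split=> //.
    * exact: L_eq.
    * apply: int_pair_set_eq => m n; rewrite lat_oddE /lat_change /mkset /= E_red
      (propF nE01) (propT E11); lia.
    * by rewrite /listed_type; tauto.
  have E_eq : lat_change 0 (0, 0) E = lat_odd 2.
    apply: int_pair_set_eq => m n; rewrite lat_oddE /lat_change /mkset /= E_red
      (propF nE01) (propF nE11); lia.
  have [r2|nr2] := pselect rank2.
    exists 0, (0, 0), lat_all, lat_all, (lat_odd 2); split=> //; first exact: L_eq.
    by rewrite /listed_type; tauto.
  exists 0, (0, 0), lat_all, lat_a2b, (lat_odd 2); split=> //.
  by rewrite /listed_type; tauto.
- have L_eq : rank2 -> lat_change 0 (0, 0) L = lat_a2b.
    move=> r2; apply: int_pair_set_eq => m n.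
    rewrite lat_a2bE /lat_change /mkset /= Leven //; lia.
  have E_mod24 m n p q : (m %% 2 = p %% 2)%Z -> (n %% 4 = q %% 4)%Z ->
      E (m, n) -> E (p, q).
    move=> hm hn Emn.
    have [h|h] : (m %% 4 = p %% 4 \/ (m + 2) %% 4 = p %% 4)%Z by lia.
      by apply: E_mod Emn.
    by apply: E_mod (E_2a _ _ Emn).
  have E_red m n : E (m, n) <->
      ((m %% 2 = 1 /\ n %% 4 = 0 /\ E (1, 0)) \/
       (m %% 2 = 1 /\ n %% 4 = 2 /\ E (1, 2)))%Z.
    split=> [Emn|[[hm [hn E10]]|[hm [hn E12]]]]; last first.
    + by apply: E_mod24 E12; lia.
    + by apply: E_mod24 E10; lia.
    have hmn := Snot _ _ Emn; have hn := Eeven _ _ Emn.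
    have [h|h] : (n %% 4 = 0 \/ n %% 4 = 2)%Z by lia.
      by left; split; [lia|split=> //; apply: E_mod24 Emn; lia].
    by right; split; [lia|split=> //; apply: E_mod24 Emn; lia].
  have [E10|nE10] := pselect (E (1, 0)); have [E12|nE12] := pselect (E (1, 2)).
  + exists 0, (0, 0), lat_all, lat_a2b, (lat_odd 2); split=> //.
    * apply: int_pair_set_eq => m n; rewrite lat_oddE /lat_change /mkset /= E_red
      (propT E10) (propT E12); lia.
    * by rewrite /listed_type; tauto.
  + exists 0, (0, 0), lat_all, lat_a2b, (lat_odd 4); split=> //.
    * apply: int_pair_set_eq => m n; rewrite lat_oddE /lat_change /mkset /= E_red
      (propT E10) (propF nE12); lia.
    * by rewrite /listed_type; tauto.
  + (* E contains a + 2 b but not a: move the origin to b *)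
    exists 0, (0, 1), lat_all, lat_a2b, (lat_odd 4); split=> //.
    * apply: int_pair_set_eq => m n; rewrite lat_oddE /lat_change /mkset /= E_red
      (propF nE10) (propT E12); lia.
    * by rewrite /listed_type; tauto.
  + by move/E_red: Ep; tauto.
Qed.

Theorem translation_sets_classification : listed_up_to_change.
Proof.
have [Sall|] := pselect (forall m n, S (m, n)); first exact: classify_full.
by move=> /existsNP [m /existsNP [n]]; apply: classify_star.
Qed.

End TranslationSetsClassification.

(** * Translation sets of an adapted frame *)

Section TranslationSetsOfFrame.
Variables (K : realType) (F : vectType K) (I : {symmetric F}).
Variables (R : set F) (G : {vspace F}) (l : nat).
Variables (c : K) (f : 'I_l -> F) (a b : F).
Hypothesis rsR : root_system I R.
Hypothesis redR : reduced R.
Hypothesis frame : adapted_frame I R G c f a b.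

Let c_neq0 : c != 0. Proof. by rewrite gt_eqF // (af_norm frame). Qed.
Let Rf := af_short frame.
Let Rff := af_middle frame.

(** The vector [m a + n b]. *)
Definition lvec (m n : int) : F := m%:~R *: a + n%:~R *: b.

Lemma bil_lvecl m n y : I (lvec m n) y = 0.
Proof. by rewrite !bilE (af_rad_a frame) (af_rad_b frame) !mulr0 addr0. Qed.

Lemma bil_lvecr m n y : I y (lvec m n) = 0.
Proof. by rewrite bilC bil_lvecl. Qed.

Lemma bil_ff i : I (f i) (f i) = c.
Proof. by rewrite (af_orth frame) eqxx mul1r. Qed.

Lemma bil_fg i j : i != j -> I (f i) (f j) = 0.
Proof. by move=> ij; rewrite (af_orth frame) (negPf ij) mul0r. Qed.

Let frE := (bil_lvecl, bil_lvecr, bil_ff, bilDl I, bilDr I, bilNl I, bilNr I, bilZl I, bilZr I).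

(** The sets [S], [L], [E] of the translations by which short, middle and long roots of type
    [BC_l] become elements of [R]. They do not depend on the sign and the indices of the
    root that is translated, see [short_setP], [middle_setP] and [long_setP]. *)
Definition short_set : set (int * int) :=
  [set p | exists (s : bool) i, R ((-1) ^+ s *: f i + lvec p.1 p.2)].

Definition middle_set : set (int * int) :=
  [set p | exists (s t : bool) i j, i != j /\
    R ((-1) ^+ s *: f i + (-1) ^+ t *: f j + lvec p.1 p.2)].

Definition long_set : set (int * int) :=
  [set p | exists (s : bool) i, R ((-1) ^+ s *: (2 *: f i) + lvec p.1 p.2)].

Let S := short_set.
Let L := middle_set.
Let E := long_set.

Lemma root_flip i y : R y -> R (y - (2 * I (f i) y / c) *: f i).
Proof. by move=> Ry; apply: (root_reflect rsR) => //; rewrite bil_ff; field. Qed.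

Lemma root_swap i j y : i != j -> R y ->
  R (y - ((I (f i) y - I (f j) y) / c) *: (f i - f j)).
Proof.
move=> ij Ry; apply: (root_reflect rsR) => //; first exact: Rff.
by rewrite !frE (bilC (f j) (f i)) bil_fg //; field.
Qed.

Lemma root_eq x y : R x -> x = y -> R y. Proof. by move=> Rx <-. Qed.

Lemma short_setP p : S p ->
  forall (s : bool) i, R ((-1) ^+ s *: f i + lvec p.1 p.2).
Proof.
move=> [s [i h]] t j.
have {h i} h : R ((-1) ^+ s *: f j + lvec p.1 p.2).
  have [<-//|ij] := eqVneq i j.
  apply: root_eq (root_swap ij h) _.
  rewrite !frE (bilC (f j)) bil_fg //.
  by rewrite (_ : _ / c = (-1) ^+ s); [vring | field].
have [<-//|st] := eqVneq s t.
apply: root_eq (root_flip j h) _; rewrite !frE.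
rewrite (_ : _ / c = 2 * (-1) ^+ s); last by field.
have -> : t = ~~ s by case: s t st {h} => -[].
by rewrite -sign_opp; vring.
Qed.

Lemma long_setP p : E p ->
  forall (s : bool) i, R ((-1) ^+ s *: (2 *: f i) + lvec p.1 p.2).
Proof.
move=> [s [i h]] t j.
have {h i} h : R ((-1) ^+ s *: (2 *: f j) + lvec p.1 p.2).
  have [<-//|ij] := eqVneq i j.
  apply: root_eq (root_swap ij h) _.
  rewrite !frE (bilC (f j)) bil_fg //.
  by rewrite (_ : _ / c = 2 * (-1) ^+ s); [vring | field].
have [<-//|st] := eqVneq s t.
apply: root_eq (root_flip j h) _; rewrite !frE.
rewrite (_ : _ / c = 4 * (-1) ^+ s); last by field.
have -> : t = ~~ s by case: s t st {h} => -[].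
by rewrite -sign_opp; vring.
Qed.

Lemma middle_setP p : L p -> forall (s t : bool) i j, i != j ->
  R ((-1) ^+ s *: f i + (-1) ^+ t *: f j + lvec p.1 p.2).
Proof.
pose M (s t : bool) i j := R ((-1) ^+ s *: f i + (-1) ^+ t *: f j + lvec p.1 p.2).
have comm s t i j : M s t i j -> M t s j i.
  by move=> h; apply: root_eq h _; rewrite (addrC (_ *: f i)).
have flip s t i j s' : i != j -> M s t i j -> M s' t i j.
  move=> ij h; have [<-//|ss] := eqVneq s s'.
  apply: root_eq (root_flip i h) _; rewrite !frE bil_fg //.
  rewrite (_ : _ / c = 2 * (-1) ^+ s); last by field.
  have -> : s' = ~~ s by case: s s' ss {h} => -[].
  by rewrite -sign_opp; vring.
have swap s t i j i' : i != j -> i' != j -> M s t i j -> M s t i' j.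
  move=> ij i'j h; have [<-//|ii'] := eqVneq i i'.
  apply: root_eq (root_swap ii' h) _; rewrite !frE.
  rewrite (bilC (f i')) !bil_fg //.
  by rewrite (_ : _ / c = (-1) ^+ s); [vring | field].
have step s t i j s' i' : i != j -> i' != j -> M s t i j -> M s' t i' j.
  by move=> ij i'j /(swap _ _ _ _ _ ij i'j); apply: flip.
move=> [s0 [t0 [i0 [j0 [ij0 h0]]]]] s t i j ij.
have ji : j != i by rewrite eq_sym.
have [ij0'|ij0'] := eqVneq i j0.
  rewrite -ij0' in ij0 h0.
  have h1 := step s0 t0 i0 i t j ij0 ji h0.
  exact: (step _ _ _ _ s i ij ij (comm _ _ _ _ h1)).
have h1 := step s0 t0 i0 j0 s i ij0 ij0' h0.
have ji1 : j0 != i by rewrite eq_sym.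
exact: (comm _ _ _ _ (step t0 s j0 i t j ji1 ji (comm _ _ _ _ h1))).
Qed.

Hypothesis l_gt0 : (0 < l)%N.
Let i0 : 'I_l := Ordinal l_gt0.

Let shortR (s : bool) i m n : S (m, n) -> R ((-1) ^+ s *: f i + lvec m n).
Proof. by move/short_setP => /(_ s i). Qed.
Let shortS (s : bool) i m n : R ((-1) ^+ s *: f i + lvec m n) -> S (m, n).
Proof. by exists s, i. Qed.
Let longR (s : bool) i m n : E (m, n) -> R ((-1) ^+ s *: (2 *: f i) + lvec m n).
Proof. by move/long_setP => /(_ s i). Qed.
Let longE (s : bool) i m n : R ((-1) ^+ s *: (2 *: f i) + lvec m n) -> E (m, n).
Proof. by exists s, i. Qed.
Let middleR (s t : bool) i j m n : i != j -> L (m, n) ->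
  R ((-1) ^+ s *: f i + (-1) ^+ t *: f j + lvec m n).
Proof. by move=> ij /middle_setP/(_ s t i j ij). Qed.
Let middleL (s t : bool) i j m n : i != j ->
  R ((-1) ^+ s *: f i + (-1) ^+ t *: f j + lvec m n) -> L (m, n).
Proof. by exists s, t, i, j. Qed.

Lemma short_set0 : S (0, 0).
Proof.
by apply: (@shortS false i0); apply: root_eq (Rf i0) _; rewrite /lvec expr0; vring.
Qed.

Lemma short_setN m n : S (m, n) -> S (- m, - n).
Proof.
move=> h; apply: (@shortS true i0); apply: root_eq (root_opp rsR (shortR false i0 h)) _.
by rewrite /lvec expr0 expr1; vring.
Qed.

Lemma long_setN m n : E (m, n) -> E (- m, - n).
Proof.
move=> h; apply: (@longE true i0); apply: root_eq (root_opp rsR (longR false i0 h)) _.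
by rewrite /lvec expr0 expr1; vring.
Qed.

(** The reflections in roots of each kind act on the translation sets; the last word of
    each name is the kind of the root that is reflected in. *)
Lemma short_set_short m n p q : S (m, n) -> S (p, q) -> S (m - 2 * p, n - 2 * q).
Proof.
move=> /(shortR false i0) h /(shortR false i0) g.
apply: (@shortS true i0); apply: root_eq (root_reflect (n := 2) rsR g h _) _.
  by rewrite !frE.
by rewrite /lvec expr0 expr1; vring.
Qed.

Lemma long_set_short m n p q : E (m, n) -> S (p, q) -> E (m - 4 * p, n - 4 * q).
Proof.
move=> /(longR false i0) h /(shortR false i0) g.
apply: (@longE true i0); apply: root_eq (root_reflect (n := 4) rsR g h _) _.
  by rewrite !frE; ring.
by rewrite /lvec expr0 expr1; vring.
Qed.

Lemma middle_set_short m n p q : L (m, n) -> S (p, q) -> L (m - 2 * p, n - 2 * q).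
Proof.
move=> h g; case: (h) => _ [_ [i [j [ij _]]]].
have {}h := middleR false false ij h; have {}g := shortR false i g.
apply: (@middleL true false i j) => //.
apply: root_eq (root_reflect (n := 2) rsR g h _) _.
  by rewrite !frE bil_fg //; ring.
by rewrite /lvec expr0 expr1; vring.
Qed.

Lemma short_set_long m n p q : S (m, n) -> E (p, q) -> S (m - p, n - q).
Proof.
move=> /(shortR false i0) h /(longR false i0) g.
apply: (@shortS true i0); apply: root_eq (root_reflect (n := 1) rsR g h _) _.
  by rewrite !frE; ring.
by rewrite /lvec expr0 expr1; vring.
Qed.

Lemma long_set_long m n p q : E (m, n) -> E (p, q) -> E (m - 2 * p, n - 2 * q).
Proof.
move=> /(longR false i0) h /(longR false i0) g.
apply: (@longE true i0); apply: root_eq (root_reflect (n := 2) rsR g h _) _.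
  by rewrite !frE; ring.
by rewrite /lvec expr0 expr1; vring.
Qed.

Lemma middle_set_long m n p q : L (m, n) -> E (p, q) -> L (m - p, n - q).
Proof.
move=> h g; case: (h) => _ [_ [i [j [ij _]]]].
have {}h := middleR false false ij h; have {}g := longR false i g.
apply: (@middleL true false i j) => //.
apply: root_eq (root_reflect (n := 1) rsR g h _) _.
  by rewrite !frE bil_fg //; ring.
by rewrite /lvec expr0 expr1; vring.
Qed.

Lemma short_set_middle m n p q : S (m, n) -> L (p, q) -> S (m - p, n - q).
Proof.
move=> h g; case: (g) => _ [_ [i [j [ij _]]]].
have {}g := middleR false true ij g; have {}h := shortR false i h.
apply: (@shortS false j); apply: root_eq (root_reflect (n := 1) rsR g h _) _.
  by rewrite !frE (bilC (f j)) !bil_fg //; ring.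
by rewrite /lvec expr0 expr1; vring.
Qed.

Lemma long_set_middle m n p q : E (m, n) -> L (p, q) -> E (m - 2 * p, n - 2 * q).
Proof.
move=> h g; case: (g) => _ [_ [i [j [ij _]]]].
have {}g := middleR false true ij g; have {}h := longR false i h.
apply: (@longE false j); apply: root_eq (root_reflect (n := 2) rsR g h _) _.
  by rewrite !frE (bilC (f j)) !bil_fg //; ring.
by rewrite /lvec expr0 expr1; vring.
Qed.

Lemma middle_setN m n : L (m, n) -> L (- m, - n).
Proof.
move=> h; case: (h) => _ [_ [i [j [ij _]]]]; apply: (@middleL true true i j) => //.
apply: root_eq (root_opp rsR (middleR false false ij h)) _.
by rewrite /lvec expr0 expr1; vring.
Qed.

Lemma long_sub_short m n : E (m, n) -> S (m, n).
Proof. by move=> /(short_set_long short_set0)/short_setN; rewrite !sub0r !opprK. Qed.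

Lemma middle_sub_short m n : L (m, n) -> S (m, n).
Proof. by move=> /(short_set_middle short_set0)/short_setN; rewrite !sub0r !opprK. Qed.

(** The radical part of the root lattice is generated by [S], [L] and [E], and hence by [S], which
    contains the other two. *)
Lemma short_set_generates (H : set (int * int)) : H (0, 0) ->
  (forall m n p q, H (m, n) -> H (p, q) -> H (m - p, n - q)) ->
  S `<=` H -> forall m n, H (m, n).
Proof.
move=> H0 HB SH m n.
pose P y := exists (z : 'I_l -> K) p q, H (p, q) /\ y = \sum_i z i *: f i + lvec p q.
have single (u : K) i : u *: f i = \sum_j (if j == i then u else 0) *: f j.
  rewrite (bigD1 i) //= eqxx big1 ?addr0 // => j /negPf ->; exact: scale0r.
have : P (lvec m n).
  apply: (int_gen_ind _ _ _ (af_gen frame m n)).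
  - exists (fun=> 0), 0, 0; split=> //; rewrite big1 => [|i _]; last exact: scale0r.
    by rewrite /lvec; vring.
  - move=> x y [z [p [q [Hpq ->]]]] [z' [p' [q' [Hpq' ->]]]].
    exists (fun i => z i - z' i), (p - p'), (q - q'); split; first exact: HB.
    have -> : \sum_i (z i - z' i) *: f i = \sum_i z i *: f i - \sum_i z' i *: f i.
      by rewrite -sumrB; apply: eq_bigr => i _; rewrite scalerBl.
    by rewrite /lvec; vring.
  - move=> y Ry; case: (af_shape frame Ry) => p [q] /= hy.
    case: hy (Ry) => [[s [i ->]]|[s [i ->]]|[s [t [i [j [ij ->]]]]]] Ry'.
    + exists (fun j => if j == i then (-1) ^+ s else 0), p, q; rewrite -single; split=> //.
      by apply/SH/shortS/Ry'.
    + exists (fun j => if j == i then (-1) ^+ s * 2 else 0), p, q.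
      rewrite -single scalerA; split=> //.
      by apply/SH/long_sub_short/longE/Ry'.
    + exists (fun h => (if h == i then (-1) ^+ s else 0) + (if h == j then (-1) ^+ t else 0)), p, q.
      split; first by apply/SH/middle_sub_short/(middleL ij)/Ry'.
      rewrite !single; congr (_ + _); rewrite -big_split /=.
      by apply: eq_bigr => h _; rewrite scalerDl.
move=> [z [p [q [Hpq trE]]]].
have z0 : \sum_i z i *: f i = 0.
  apply: big1 => i _; suff -> : z i = 0 by rewrite scale0r.
  apply: (mulIf c_neq0); rewrite mul0r -(orthogonal_family_coef z i (af_orth frame)).
  by rewrite -[\sum__ _](addrK (lvec p q)) -trE bilDr bilNr !bil_lvecr subrr.
rewrite z0 add0r in trE.
have /(af_free frame)[mp nq] : (m - p)%:~R *: a + (n - q)%:~R *: b = 0.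
  have : lvec m n - lvec p q = 0 by rewrite trE subrr.
  by move=> <-; rewrite /lvec; vring.
have -> : m = p by apply/eqP; rewrite -subr_eq0 -(intr_eq0 K) mp.
by have -> : n = q by apply/eqP; rewrite -subr_eq0 -(intr_eq0 K) nq.
Qed.

Hypothesis nonred : exists x y, [/\ R x, R y, I x x = c & y - 2 *: x \in G].

(** The roots [x] and [y] have norms [c] and [4 c], hence are short and long. *)
Lemma nonreduced_translations : exists m n p, S (m, n) /\ E (p, 2 * n).
Proof.
have [x [y [Rx Ry xx yx]]] := nonred.
have [m [n xE]] : exists m n, exists (s : bool) i, x = (-1) ^+ s *: f i + lvec m n.
  have [m [n /= hx]] := af_shape frame Rx; exists m, n.
  case: hx => [//|[s [i xE]]|[s [t [i [j [ij xE]]]]]]; have c_gt0 := af_norm frame.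
    have : I x x = 4 * ((-1) ^+ s * (-1) ^+ s) * c.
      by rewrite xE -/(lvec m n) !frE; ring.
    by rewrite sign_mulss xx => ?; lra.
  have : I x x = ((-1) ^+ s * (-1) ^+ s + (-1) ^+ t * (-1) ^+ t) * c.
    by rewrite xE -/(lvec m n) !frE (bilC (f j)) bil_fg //; ring.
  by rewrite !sign_mulss xx => ?; lra.
case: xE => s [i xE].
have [k yE] : exists k, y = 2 *: x + k *: a.
  move: yx; rewrite (af_marking frame) => /vlineP[k yk]; exists k.
  by rewrite -yk addrC subrK.
have yy : I y y = 4 * c.
  by rewrite yE !bilE (af_rad_a frame) (bilC x) !(af_rad_a frame) xx; ring.
have Iyf : I y (f i) = 2 * (-1) ^+ s * c.
  by rewrite yE xE !frE (af_rad_a frame); ring.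
have [p [q /= hy]] := af_shape frame Ry.
have c_gt0 := af_norm frame.
case: hy => [[t [j yE']]|[t [j yE']]|[t [u [j [h [jh yE']]]]]].
- have : I y y = ((-1) ^+ t * (-1) ^+ t) * c by rewrite yE' -/(lvec p q) !frE; ring.
  by rewrite sign_mulss yy => ?; lra.
- exists m, n, p; split; first by apply: (@shortS s i); rewrite -xE.
  have Epq : E (p, q) by apply: (@longE t j); rewrite -yE'.
  have ji : j = i.
    apply/eqP/negPn/negP => ji; move: Iyf; rewrite yE' -/(lvec p q) !frE bil_fg //.
    move=> /esym/eqP; rewrite !mulr0 addr0 !mulf_eq0 signr_eq0 (negPf c_neq0).
    by rewrite pnatr_eq0.
  have ts : t = s.
    move: Iyf; rewrite yE' ji -/(lvec p q) !frE => h.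
    have : (-1) ^+ t = (-1) ^+ s :> K by apply: (mulIf c_neq0); lra.
    by move/signr_inj.
  suff -> : 2 * n = q by [].
  have /(af_free frame)[_ ] : (2 * m%:~R + k - p%:~R) *: a + (2 * n - q)%:~R *: b = 0.
    have : y - y = 0 by rewrite subrr.
    by rewrite {1}yE yE' xE ji ts => <-; rewrite /lvec; vring.
  by move=> nq; apply/eqP; rewrite -subr_eq0 -(intr_eq0 K) nq.
- have : I y y = ((-1) ^+ t * (-1) ^+ t + (-1) ^+ u * (-1) ^+ u) * c.
    by rewrite yE' -/(lvec p q) !frE (bilC (f h)) bil_fg //; ring.
  by rewrite !sign_mulss yy => ?; lra.
Qed.

(** As [S] generates the lattice, a set of lattice vectors that is stable under the translations
    by [- d s], with [s] in [S], is stable under all translations by multiples of [d]. *)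
Lemma translation_periodic (d : int) (A : set (int * int)) :
  (forall m n p q, A (m, n) -> S (p, q) -> A (m - d * p, n - d * q)) ->
  forall m n i j, A (m, n) -> A (m + d * i, n + d * j).
Proof.
move=> AS m n i j.
pose H := [set p : int * int | forall m n, A (m, n) ->
  A (m + d * p.1, n + d * p.2) /\ A (m - d * p.1, n - d * p.2)].
have A_eq p q p' q' : A (p, q) -> p = p' -> q = q' -> A (p', q').
  by move=> ? <- <-.
suff : H (i, j) by move=> h /h[].
apply: (short_set_generates (H := H)).
- by move=> x y Axy; split; apply: (A_eq _ _ _ _ Axy) => /=; ring.
- move=> p q p' q' h h' x y Axy /=; split.
    have [/h'[_ h1] _] := h _ _ Axy.
    by apply: (A_eq _ _ _ _ h1) => /=; ring.
  have [_ /h'[h1 _]] := h _ _ Axy.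
  by apply: (A_eq _ _ _ _ h1) => /=; ring.
- move=> [p q] Spq x y Axy /=; split; last exact: AS.
  by have := AS _ _ _ _ Axy (short_setN Spq); rewrite !mulrN !opprK.
Qed.

Theorem frame_translation_sets : translation_sets (2 <= l)%N S L E.
Proof.
split.
- exact: short_set0.
- exact: (translation_periodic short_set_short).
- move=> u v uv; apply: contrapT => none.
  pose H := [set p : int * int | ((u * p.1 + v * p.2) %% 2 = 0)%Z].
  have Hall : forall m n, H (m, n).
    apply: (short_set_generates (H := H)); first by rewrite /H /= !mulr0.
      by move=> m n p q; rewrite /H /= => h1 h2; move: h1 h2; lia.
    move=> [m n] Smn; apply: contrapT => /= h; apply: none; exists m, n; split=> //.
    by move: h; rewrite /H /=; lia.
  have := Hall 1 0; have := Hall 0 1; rewrite /H /= !mulr1 !mulr0; lia.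
- exact: (translation_periodic long_set_short).
- exact: long_setN.
- move=> m n p q Em Ep; have := long_setN (long_set_long Ep Em).
  by rewrite !opprB.
- move=> m n p q Sm Ep; have := short_set_long Sm (long_setN Ep).
  by rewrite !opprK.
- move=> m n Sm Em; have := redR (shortR false i0 Sm) (c := 2).
  have -> : 2 *: ((-1) ^+ false *: f i0 + lvec m n) =
      (-1) ^+ false *: (2 *: f i0) + lvec (2 * m) (2 * n).
    by rewrite /lvec expr0; vring.
  by move=> /(_ (longR false i0 Em)); lra.
- exact: nonreduced_translations.
- move=> l2; pose i1 : 'I_l := Ordinal l2.
  have i01 : i0 != i1 by [].
  apply: (@middleL false true _ _ _ _ i01); apply: root_eq (Rff i01) _.
  by rewrite /lvec expr0 expr1; vring.
- by move=> _; apply: (translation_periodic middle_set_short).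
- move=> _ m n p q Sm Lp; have := short_set_middle Sm (middle_setN Lp).
  by rewrite !opprK.
- move=> _ m n p q Lm Ep; have := middle_set_long Lm (long_setN Ep).
  by rewrite !opprK.
- move=> _ m n p q Em Lp; have := long_set_middle Em (middle_setN Lp).
  by rewrite !mulrN !opprK.
Qed.

End TranslationSetsOfFrame.

(** * Isomorphism with the standard root systems *)

Section StandardCoordinates.
Variables (K : realType) (F : vectType K) (l : nat).
Variables (e : 'I_l -> F) (a b : F).

(** The linear map from the standard space that sends the standard basis to [e], [b], [a]. *)
Definition from_std (v : std_space K l) : F :=
  \sum_i v.1.1 0 i *: e i + (v.1.2 : K) *: b + (v.2 : K) *: a.

Lemma from_std_is_linear : linear from_std.
Proof.
move=> k u v; rewrite /from_std.
have -> : \sum_i (k *: u + v).1.1 0 i *: e i =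
    k *: (\sum_i u.1.1 0 i *: e i) + \sum_i v.1.1 0 i *: e i.
  rewrite scaler_sumr -big_split /=; apply: eq_bigr => i _.
  by rewrite !mxE scalerDl scalerA.
have -> : (k *: u + v).1.2 = k * u.1.2 + v.1.2 :> K by [].
have -> : (k *: u + v).2 = k * u.2 + v.2 :> K by [].
by vring.
Qed.

HB.instance Definition _ :=
  GRing.isLinear.Build K (std_space K l) F *:%R from_std from_std_is_linear.

Lemma from_std_eps i : from_std (std_eps K i) = e i.
Proof.
rewrite /from_std (bigD1 i) //= big1 => [|j ji].
  by rewrite mxE !eqxx scale1r !scale0r !addr0.
by rewrite mxE (negPf ji) andbF scale0r.
Qed.

Lemma from_std_b : from_std (std_b K l) = b.
Proof.
rewrite /from_std /= big1 => [|i _]; last by rewrite mxE scale0r.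
by rewrite scale1r scale0r add0r addr0.
Qed.

Lemma from_std_a : from_std (std_a K l) = a.
Proof.
rewrite /from_std /= big1 => [|i _]; last by rewrite mxE scale0r.
by rewrite scale1r scale0r !add0r.
Qed.

Lemma from_std_translate v m n :
  from_std (v + (std_a K l *~ m + std_b K l *~ n)) = from_std v + lvec a b m n.
Proof.
by rewrite !raddfD /= !raddfMz /= from_std_a from_std_b /lvec !scaler_int.
Qed.

End StandardCoordinates.

Section Isomorphism.
Variables (K : realType) (F : vectType K) (I : {symmetric F}).
Variables (R : set F) (G : {vspace F}) (l : nat).
Variables (c : K) (f : 'I_l -> F) (a b : F).
Hypothesis rsR : root_system I R.
Hypothesis frame : adapted_frame I R G c f a b.
Variables (k : int) (t : int * int) (S' L' E' : set (int * int)).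

Let S := short_set R f a b.
Let L := middle_set R f a b.
Let E := long_set R f a b.
Hypothesis ts : translation_sets (2 <= l)%N S L E.
Hypothesis S'E : lat_change k t S = S'.
Hypothesis L'E : (2 <= l)%N -> lat_change k (0, 0) L = L'.
Hypothesis E'E : lat_change k (2 * t.1, 2 * t.2) E = E'.

(** The new coordinate vectors; the [e i] need not be roots. *)
Let e i := f i + lvec a b t.1 t.2.
Let b' := b + k%:~R *: a.

Lemma short_change (s : bool) i m n : (-1) ^+ s *: e i + lvec a b' m n =
  (-1) ^+ s *: f i + lvec a b (m + k * n + (-1) ^+ s * t.1) (n + (-1) ^+ s * t.2).
Proof. by rewrite /e /lvec /b'; case: s; rewrite ?expr0 ?expr1; vring. Qed.

Lemma long_change (s : bool) i m n : (-1) ^+ s *: (2 *: e i) + lvec a b' m n =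
  (-1) ^+ s *: (2 *: f i) +
  lvec a b (m + k * n + (-1) ^+ s * (2 * t.1)) (n + (-1) ^+ s * (2 * t.2)).
Proof. by rewrite /e /lvec /b'; case: s; rewrite ?expr0 ?expr1; vring. Qed.

Lemma middle_change (s u : bool) i j m n :
  (-1) ^+ s *: e i + (-1) ^+ u *: e j + lvec a b' m n =
  (-1) ^+ s *: f i + (-1) ^+ u *: f j +
  lvec a b (m + k * n + ((-1) ^+ s + (-1) ^+ u) * t.1)
         (n + ((-1) ^+ s + (-1) ^+ u) * t.2).
Proof. by rewrite /e /lvec /b'; case: s; case: u; rewrite ?expr0 ?expr1; vring. Qed.

Lemma change_surj (p q : int) m n : exists m' n',
  m = m' + k * n' + p /\ n = n' + q.
Proof. by exists (m - k * (n - q) - p), (n - q); split; ring. Qed.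

Lemma short_root_change (s : bool) i m n :
  R ((-1) ^+ s *: e i + lvec a b' m n) <-> S' (m, n).
Proof.
rewrite short_change -S'E.
apply: (@iff_trans _ (S (m + k * n + (-1) ^+ s * t.1, n + (-1) ^+ s * t.2))).
  split=> [h|/(short_setP rsR frame)]; first by exists s, i.
  exact.
rewrite /lat_change /mkset /=.
by split; apply: (periodic_mod (ts_S_per ts)); case: s; rewrite ?expr0 ?expr1; lia.
Qed.

Lemma long_root_change (s : bool) i m n :
  R ((-1) ^+ s *: (2 *: e i) + lvec a b' m n) <-> E' (m, n).
Proof.
rewrite long_change -E'E.
apply: (@iff_trans _ (E (m + k * n + (-1) ^+ s * (2 * t.1), n + (-1) ^+ s * (2 * t.2)))).
  split=> [h|/(long_setP rsR frame)]; first by exists s, i.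
  exact.
rewrite /lat_change /mkset /=.
by split; apply: (periodic_mod (ts_E_per ts)); case: s; rewrite ?expr0 ?expr1; lia.
Qed.

Lemma middle_root_change (s u : bool) i j m n : i != j ->
  R ((-1) ^+ s *: e i + (-1) ^+ u *: e j + lvec a b' m n) <-> L' (m, n).
Proof.
move=> ij; have l2 : (2 <= l)%N.
  rewrite ltnNge; apply/negP => l1; case/eqP: ij; apply/val_inj.
  by have := ltn_ord i; have := ltn_ord j; rewrite /=; lia.
rewrite middle_change -(L'E l2).
apply: (@iff_trans _ (L (m + k * n + ((-1) ^+ s + (-1) ^+ u) * t.1,
                         n + ((-1) ^+ s + (-1) ^+ u) * t.2))).
  split=> [h|/(middle_setP rsR frame)]; first by exists s, u, i, j.
  exact.
rewrite /lat_change /mkset /=.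
by split; apply: (periodic_mod (ts_L_per ts l2)); case: s; case: u; rewrite ?expr0 ?expr1; lia.
Qed.

Lemma std_roots_in_R z : @std_roots K l S' L' E' z -> R (from_std e a b' z).
Proof.
move=> [[|]|] [v hv [[m n] hp <-]]; rewrite from_std_translate.
- case: hv => s [i ->]; rewrite linearZ /= from_std_eps.
  exact/short_root_change.
- case: hv => s [u [i [j [ij ->]]]]; rewrite linearD !linearZ /= !from_std_eps.
  by apply/middle_root_change => //; rewrite neq_ltn ij.
- case: hv => s [i ->]; rewrite !linearZ /= from_std_eps.
  exact/long_root_change.
Qed.

Lemma R_in_std_roots y : R y ->
  exists2 z, @std_roots K l S' L' E' z & from_std e a b' z = y.
Proof.
move=> Ry; have [m [n /= hy]] := af_shape frame Ry.
have middle (s u : bool) (i j : 'I_l) : (i < j)%N ->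
    y = (-1) ^+ s *: f i + (-1) ^+ u *: f j + lvec a b m n ->
    exists2 z, @std_roots K l S' L' E' z & from_std e a b' z = y.
  move=> ij yE.
  have [m' [n' [mE nE]]] := change_surj (((-1) ^+ s + (-1) ^+ u) * t.1)
    (((-1) ^+ s + (-1) ^+ u) * t.2) m n.
  rewrite mE nE -middle_change in yE.
  exists ((-1) ^+ s *: std_eps K i + (-1) ^+ u *: std_eps K j +
    (std_a K l *~ m' + std_b K l *~ n')).
    left; right; exists ((-1) ^+ s *: std_eps K i + (-1) ^+ u *: std_eps K j).
      by exists s, u, i, j.
    exists (m', n') => //; apply/(@middle_root_change s u i j); last by rewrite -yE.
    by rewrite neq_ltn ij.
  by rewrite from_std_translate linearD !linearZ /= !from_std_eps.
case: hy => [[s [i yE]]|[s [i yE]]|[s [u [i [j [ij yE]]]]]].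
- have [m' [n' [mE nE]]] := change_surj ((-1) ^+ s * t.1) ((-1) ^+ s * t.2) m n.
  rewrite mE nE -/(lvec a b _ _) -short_change in yE.
  exists ((-1) ^+ s *: std_eps K i + (std_a K l *~ m' + std_b K l *~ n')).
    left; left; exists ((-1) ^+ s *: std_eps K i); first by exists s, i.
    by exists (m', n') => //; apply/(@short_root_change s i); rewrite -yE.
  by rewrite from_std_translate linearZ /= from_std_eps.
- have [m' [n' [mE nE]]] :=
    change_surj ((-1) ^+ s * (2 * t.1)) ((-1) ^+ s * (2 * t.2)) m n.
  rewrite mE nE -/(lvec a b _ _) -long_change in yE.
  exists ((-1) ^+ s *: (2 *: std_eps K i) + (std_a K l *~ m' + std_b K l *~ n')).
    right; exists ((-1) ^+ s *: (2 *: std_eps K i)); first by exists s, i.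
    by exists (m', n') => //; apply/(@long_root_change s i); rewrite -yE.
  by rewrite from_std_translate !linearZ /= from_std_eps.
- have [ltij|ltji] : (i < j)%N \/ (j < i)%N.
    by apply/orP; rewrite -neq_ltn.
    exact: middle yE.
  by apply: (middle u s j i ltji); rewrite yE (addrC (_ *: f i)).
Qed.

Theorem frame_isomorphic :
  mers_isomorphic R G (@std_roots K l S' L' E') (std_marking K l).
Proof.
pose psi := linfun (from_std e a b').
have psiE z : psi z = from_std e a b' z by rewrite lfunE.
have tr_rad m n y : I (lvec a b m n) y = 0 := bil_lvecl frame m n y.
have inj : lker psi == 0%VS.
  apply/lker0P => u v /eqP; rewrite -subr_eq0 -linearB /= => /eqP.
  set w := u - v; rewrite psiE => w0.
  suff w00 : w = 0 by apply/eqP; rewrite -subr_eq0 -/w w00.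
  have c0 : c != 0 by rewrite gt_eqF // (af_norm frame).
  have w1 i : w.1.1 0 i = 0.
    have : I (f i) (from_std e a b' w) = 0 by rewrite w0 bil0r.
    rewrite /from_std /b' !(bilDr, bilZr).
    rewrite !(bilC (f i) a) !(bilC (f i) b) (af_rad_a frame) (af_rad_b frame).
    rewrite !(mulr0, addr0) => h; apply: (mulIf c0); rewrite mul0r -[RHS]h.
    rewrite -(orthogonal_family_coef (fun i => w.1.1 0 i) i (af_orth frame)).
    rewrite !bil_sumr; apply: eq_bigr => j _.
    by rewrite /e !bilZr bilDr (bilC (f i) (lvec _ _ _ _)) tr_rad addr0.
  have : (w.1.2 * k%:~R + w.2) *: a + (w.1.2 : K) *: b = 0.
    rewrite -w0 /from_std big1 => [|i _]; last by rewrite w1 scale0r.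
    by rewrite /b'; vring.
  move=> /(af_free frame)[w3 w2]; rewrite w2 mul0r add0r in w3.
  move: w1 w2 w3; case: (w) => [[w1 w2] w3] /= h1 -> ->.
  by congr (_, _, _); apply/rowP => i; rewrite h1 mxE.
have surj : limg psi = fullv.
  apply: (mem_span_root (root_lattice rsR)) => y /R_in_std_roots[z _ <-].
  by rewrite -psiE memv_img ?memvf.
have psiK : cancel psi (psi^-1)%VF := lker0_lfunK inj.
have psiVK : cancel (psi^-1)%VF psi.
  by move=> y; rewrite limg_lfunVK // surj memvf.
exists (psi^-1)%VF; split.
- by exists psi.
- apply/seteqP; split=> [_ [y Ry <-]|z zR].
    by have [z zR <-] := R_in_std_roots Ry; rewrite -psiE psiK.
  by exists (psi z); rewrite ?psiK // psiE; apply: std_roots_in_R.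
- rewrite (af_marking frame) limg_line /std_marking; congr <[_]>%VS.
  by rewrite -[RHS]psiK psiE from_std_a.
Qed.

End Isomorphism.

Theorem theorem4p1 (K : realType) (l : nat) (F : vectType K) (I : {symmetric F})
    (R : set F) (G : {vspace F}) (l_ge1 : (1 <= l)%N)
    (mersRG : marked_elliptic I l R G)
    (redR : reduced R) (nonredRG : ~ reduced (quo_roots R G)) :
     mers_isomorphic R G (BC_1_2 K l) (std_marking K l)
  \/ mers_isomorphic R G (BC_1_1_star K l) (std_marking K l)
  \/ mers_isomorphic R G (BC_4_2 K l) (std_marking K l)
  \/ mers_isomorphic R G (BC_4_4_star K l) (std_marking K l)
  \/ mers_isomorphic R G (BC_2_2_sigma_2 K l) (std_marking K l)
  \/ ((2 <= l)%N /\ mers_isomorphic R G (BC_2_2_sigma_1 K l) (std_marking K l)).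
Proof.
have rsR := mers_root_system mersRG.
have [c [f [a [b [frame nonred]]]]] := adapted_frame_exists mersRG nonredRG.
have ts := frame_translation_sets rsR redR frame l_ge1 nonred.
have [k [t [S' [L' [E' [S'E L'E E'E listed]]]]]] := translation_sets_classification ts.
have iso := frame_isomorphic rsR frame ts S'E L'E E'E.
rewrite /BC_1_2 /BC_1_1_star /BC_4_2 /BC_4_4_star /BC_2_2_sigma_2 /BC_2_2_sigma_1.
move: listed iso => {S'E L'E E'E} [|[|[|[|[|[l2]]]]]] [-> -> ->] iso.
- by left.
- by right; left.
- by do 2 right; left.
- by do 3 right; left.
- by do 4 right; left.
- by do 5 right.
Qed.
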